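(* Suppose $x\neq 0$. If $x\notin\mathbb{Z}$, then the algebra $\mathbb{A}_n(x)$ is semisimple.
   Context: Let $K$ be a field, $x$ an element transcendental or algebraic over $K$, and $F=K(x)$, assumed of characteristic zero; ''semisimple'' means isomorphic to a finite direct product of full matrix algebras over $F$, and $x\notin\mathbb{Z}$ means $x$ is not in the image of $\mathbb{Z}$ in $F$. Let $\mathscr{A}_n$ be the set of graphs on $\{1,\dots,n\}\cup\{1',\dots,n'\}$ (top row $1,\dots,n$, bottom row $1',\dots,n'$) in which every vertex has degree $0$ or $1$ (degree-$0$ vertices are said to carry loops). For diagrams $\mathfrak a,\mathfrak b$, stack $\mathfrak a$ above $\mathfrak b$ identifying bottom vertex $i'$ of $\mathfrak a$ with top vertex $i$ of $\mathfrak b$; let $\ell(\mathfrak a,\mathfrak b)$ be the number of connected components lying entirely in the middle row and $G'(\mathfrak a,\mathfrak b)$ the diagram on the top row of $\mathfrak a$ and bottom row of $\mathfrak b$ joining two vertices iff they are connected by a path; set $\mathfrak a\mathfrak b=x^{\ell(\mathfrak a,\mathfrak b)}G'(\mathfrak a,\mathfrak b)$. $\mathbb{A}_n(x)$ is the $F$-algebra with basis $\mathscr{A}_n$ and this (bilinearly extended) product. *)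

(* Defs.v *)
From mathcomp Require Import all_boot all_order all_algebra.
Set Implicit Arguments. Unset Strict Implicit. Unset Printing Implicit Defensive.
Import GRing.Theory.
Local Open Scope ring_scope.

(* Vertices of an n-diagram: (false, i) = top vertex i, (true, i) = bottom vertex i'. *)
Definition vtx (n : nat) : finType := (bool * 'I_n)%type.

(* A graph on the 2n vertices in which every vertex has degree 0 or 1 is encoded
   as an involution d on the vertices: v -- d v is an edge when d v != v, and
   the fixed points of d are the degree-0 vertices. *)
Definition is_diagram n (d : {ffun vtx n -> vtx n}) : bool := [forall v, d (d v) == v].

Definition diagram (n : nat) : finType := {d : {ffun vtx n -> vtx n} | is_diagram d}.

(* Stacking: vertices of three rows, row 0 = top of a, row 1 = middle
   (bottom of a = top of b), row 2 = bottom of b. *)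
Definition svtx (n : nat) : finType := ('I_3 * 'I_n)%type.

Definition row0 : 'I_3 := Ordinal (isT : 0 < 3)%N.
Definition row1 : 'I_3 := Ordinal (isT : 1 < 3)%N.
Definition row2 : 'I_3 := Ordinal (isT : 2 < 3)%N.

Definition embA n (v : vtx n) : svtx n := (if v.1 then row1 else row0, v.2).
Definition embB n (v : vtx n) : svtx n := (if v.1 then row2 else row1, v.2).
Definition embO n (v : vtx n) : svtx n := (if v.1 then row2 else row0, v.2).

Definition stack_edge n (a b : diagram n) : rel (svtx n) := fun w1 w2 =>
  [exists v, ((val a v != v) && (embA v == w1) && (embA (val a v) == w2))
          || ((val b v != v) && (embB v == w1) && (embB (val b v) == w2))].

(* l(a,b): number of connected components lying entirely in the middle row
   (counted through their canonical representatives [root]). *)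
Definition loops n (a b : diagram n) : nat :=
  #|[set w : svtx n | (w.1 == row1) && (fingraph.root (stack_edge a b) w == w)
        && [forall w', connect (stack_edge a b) w w' ==> (w'.1 == row1)]]|.

Definition stackG n (a b : diagram n) : {ffun vtx n -> vtx n} :=
  [ffun v => odflt v [pick u | (u != v) && connect (stack_edge a b) (embO v) (embO u)]].

(* The algebra A_n(x): elements are F-linear combinations of diagrams,
   represented by their coefficient functions; product a b = x^l(a,b) G'(a,b)
   extended bilinearly. *)
Definition amul (F : fieldType) n (x : F) (u v : {ffun diagram n -> F})
  : {ffun diagram n -> F} :=
  [ffun c => \sum_(a : diagram n) \sum_(b : diagram n)
      (if stackG a b == val c then u a * v b * x ^+ loops a b else 0)].

(* A_n(x) is semisimple: isomorphic (as F-algebra) to a finite direct product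
   of full matrix algebras M_{d_i}(F), i < k. The isomorphism is given
   componentwise by maps phi i, which are F-linear and multiplicative, and
   jointly bijective. *)
Definition rook_brauer_semisimple (F : fieldType) n (x : F) : Prop :=
  exists (k : nat) (d : 'I_k -> nat)
         (phi : forall i : 'I_k, {ffun diagram n -> F} -> 'M[F]_(d i)),
    [/\ forall i (c : F) (u v : {ffun diagram n -> F}), phi i [ffun a => c * u a + v a] = c *: phi i u + phi i v,
        forall i (u v : {ffun diagram n -> F}), phi i (amul x u v) = phi i u *m phi i v,
        forall u v : {ffun diagram n -> F}, (forall i, phi i u = phi i v) -> u = v
      & forall M : (forall i : 'I_k, 'M[F]_(d i)),
          exists u, forall i, phi i u = M i].

(* Main.v *)
Require Import Defs.
From HB Require Import structures.
From mathcomp Require Import all_boot all_order all_algebra all_fingroup falgebra zify.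
From Stdlib Require Ncring Ncring_tac.
Set Implicit Arguments. Unset Strict Implicit. Unset Printing Implicit Defensive.
Import GRing.Theory.
Import Defs.

(** Let [f_k] be the idempotent diagram of the first [k] strands (the others being
    isolated and normalised by [1/x]).  The ideals [A f_k A] filter the algebra by the
    number of through strands.  The point is that the ideal [A f_(k-1) A] has a unit
    in [f_k A f_k]: there is an idempotent [z_k] in [f_k + A f_(k-1) A] killed on both
    sides by the isolated vertices and the contractions among the first [k] strands.
    Splitting off the isolated vertices by [P = prod (1 - p_i)] turns the contractions
    into those of a Brauer algebra with parameter [x - 1]; there [z_k] is a product of
    polynomials in the Jucys-Murphy elements, which exist because the eigenvalues
    of these elements are integers on permutations and non-integers of the form
    [2 - x - c] on contractions.  Then [z_k A z_k] is [z_k F[S_k]], [z_k A z_l = 0]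
    for distinct [k] and [l], and the [z_k] generate [A] as an ideal, so that the
    primitive idempotents of [F[S_k]], cut out by [z_k], exhibit [A] as a product
    of matrix algebras over [F].

    Those of [F[S_k]] are the joint spectral projections of its Jucys-Murphy elements
    (Okounkov and Vershik); that [E F[S_k] E = F E] follows by induction on [k]
    from the double coset decomposition [S_(k+1) = S_k + S_k s_k S_k]. *)

(** * Components of a stack of two diagrams *)

(** The parameter drops to [x - 1] because a closed loop contributes [x], while the same loop cut
    open by a normalised isolated vertex contributes [1]; inserting [1 - p_i] leaves the difference.
    With [delta = x - 1], a contraction [e] satisfies [e s = e] and [e e = delta e], and these two
    terms enter the Jucys-Murphy element with opposite signs: hence the constant
    [1 - delta = 2 - x]. No extension of [F] is made: all eigenvalues used to split [F[S_k]] are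
    integers. Characteristic zero enters mainly through the trace of the regular representation of
    [S_n], which shows that [a F[S_k] a = 0] only for [a = 0]; this semiprimality stands in for
    complete reducibility. Associativity and the relations between diagrams are not obtained by
    following paths. At parameter 2 the diagrams act on tensors over a two-dimensional space by
    matrices with entries 0 and 1. A single diagram and the exponent of a power of 2 can be read off
    such a matrix, so an identity between monomials checked there holds for every [x]. *)

Section Dihedral.
Variables (T : finType) (al be : T -> T).
Hypotheses (alK : involutive al) (beK : involutive be).

Let f x := al (be x).

Let f_inj : injective f.
Proof. by exact: inj_comp (inv_inj alK) (inv_inj beK). Qed.

(** [be] conjugates [f] to its inverse, the defining relation of a dihedral group. *)
Lemma iter_dihedral k x : iter k f (be (iter k f x)) = be x.
Proof.
elim: k x => // k IHk x; rewrite iterS iterSr /f IHk /f.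
by rewrite beK alK.
Qed.

(** Since [be] fixes [u], the orbit of [u] under both involutions is already its orbit under the
    rotation [f]. *)
Lemma dihedral_orbit (e : rel T) u v :
    (forall x y, e x y -> y = al x \/ y = be x) ->
  be u = u -> connect e u v -> fconnect f u v.
Proof.
move=> he hu /connectP[p hp ->] {v}.
suff gen x : fconnect f u x -> path e x p -> fconnect f u (last x p).
  exact: gen (connect0 _ _) hp.
elim: p x {hp} => //= y p IHp x ux /andP[exy hp].
apply: IHp hp; have := iter_dihedral (findex f u x) u.
rewrite (iter_findex ux) hu => hk.
have ubx : fconnect f u (be x).
  by rewrite (fconnect_sym f_inj) -[X in fconnect _ _ X]hk fconnect_iter.
case: (he _ _ exy) => ->; last by [].
have -> : al x = f (be x) by rewrite /f beK.
exact: connect_trans ubx (fconnect1 _ _).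
Qed.

(* On the [f]-orbit of [u], of length [m], the maps [al] and [be] are reflections
   with two fixed points altogether, [u] and the point at distance [uphalf m]. *)
Lemma dihedral_ends (e : rel T) u v w :
    (forall x y, e x y -> y = al x \/ y = be x) -> be u = u ->
    al v = v \/ be v = v -> al w = w \/ be w = w ->
  connect e u v -> connect e u w -> v != u -> w != u -> v = w.
Proof.
move=> he hu.
pose m := fingraph.order f u.
have key y : al y = y \/ be y = y -> connect e u y -> y != u ->
    exists2 k, y = iter k f u & k = uphalf m.
  move=> hy /(dihedral_orbit he hu) uy yu.
  have hk := iter_dihedral (findex f u y) u; rewrite hu iter_findex // in hk.
  have km : findex f u y < m by apply: findex_max.
  have small j : j < m -> iter j f u = u -> j = 0.
    by move=> jm ju; rewrite -(findex_iter jm) ju findex0.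
  have period j : 0 < j -> j < m + m -> iter j f u = u -> j = m.
    move=> j0 jm ju; have [/small/(_ ju) j00|mj] := ltnP j m.
      by rewrite j00 in j0.
    rewrite -(subnK mj) iterD iter_order // in ju.
    have /small/(_ ju) : j - m < m by lia.
    by lia.
  have k0 : 0 < findex f u y.
    rewrite lt0n; apply: contraNneq yu => k0.
    by rewrite -(iter_findex uy) k0.
  exists (findex f u y); first by rewrite iter_findex.
  have yk := iter_findex uy; set k := findex f u y in hk km k0 yk *.
  (* At distance [k] from [u], a fixed point of [be] forces [2k = m] and one of [al] forces
     [2k - 1 = m]; either way [k = uphalf m]. *)
  case: hy => hy; last first.
    have /period : iter (k + k) f u = u by rewrite iterD yk -{1}hy.
    by lia.
  have /period : iter (k + k).-1 f u = u.
    apply: f_inj; rewrite -iterS prednK ?addn_gt0 ?k0 // iterD yk -[in RHS]hk.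
    by rewrite -iterS iterSr /f beK hy.
  by lia.
move=> hv hw uv uw vu wu.
have [k -> ->] := key _ hv uv vu; have [k' -> ->] := key _ hw uw wu.
by [].
Qed.

End Dihedral.

Section Stack.
Variable n : nat.
Implicit Types (a b c d : diagram n) (f g h : {ffun 'I_n -> bool}).

Lemma diagramK d : involutive (val d).
Proof. by move=> v; apply/eqP; have /forallP/(_ v) := valP d. Qed.

(** Completed by the identity on the bottom row, the edges of [a] form an involution of all three
    rows; likewise for [b]. The stack becomes the graph of two involutions. *)
Definition upper a (w : svtx n) : svtx n :=
  if w.1 == row2 then w else embA (val a (w.1 == row1, w.2)).
Definition lower b (w : svtx n) : svtx n :=
  if w.1 == row0 then w else embB (val b (w.1 == row2, w.2)).

Lemma row_cases (r : 'I_3) : [\/ r = row0, r = row1 | r = row2].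
Proof.
by case: r => [[|[|[|r]]] hr] //; [constructor 1|constructor 2|constructor 3];
  apply/val_inj.
Qed.

Lemma upperA a v : upper a (embA v) = embA (val a v).
Proof. by case: v => -[] i. Qed.

Lemma lowerB b v : lower b (embB v) = embB (val b v).
Proof. by case: v => -[] i. Qed.

Lemma embA_inj : injective (@embA n).
Proof. by case=> -[] i [[] j] //= [->]. Qed.

Lemma embB_inj : injective (@embB n).
Proof. by case=> -[] i [[] j] //= [->]. Qed.

Lemma embO_inj : injective (@embO n).
Proof. by case=> -[] i [[] j] //= [->]. Qed.

Lemma upperK a : involutive (upper a).
Proof.
move=> [r i]; case: (row_cases r) => ->; last by [].
  by rewrite -[(row0, i)]/(embA (false, i)) !upperA diagramK.
by rewrite -[(row1, i)]/(embA (true, i)) !upperA diagramK.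
Qed.

Lemma lowerK b : involutive (lower b).
Proof.
move=> [r i]; case: (row_cases r) => ->; first by [].
  by rewrite -[(row1, i)]/(embB (false, i)) !lowerB diagramK.
by rewrite -[(row2, i)]/(embB (true, i)) !lowerB diagramK.
Qed.

Lemma stack_edgeE a b w1 w2 :
  stack_edge a b w1 w2 = (w1 != w2) && ((w2 == upper a w1) || (w2 == lower b w1)).
Proof.
apply/existsP/andP.
  move=> [v /orP[/andP[/andP[hv /eqP<-] /eqP<-]|/andP[/andP[hv /eqP<-] /eqP<-]]].
    by rewrite upperA eqxx (inj_eq embA_inj) eq_sym.
  by rewrite lowerB eqxx (inj_eq embB_inj) eq_sym orbT.
case=> hw /orP[] /eqP e; rewrite e in hw *; case: w1 hw {e} => r i.
  case: (row_cases r) => -> //= hw; last by rewrite /upper /= eqxx in hw.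
    by exists (false, i); rewrite -[(row0, i)]/(embA (false, i)) upperA
      (inj_eq embA_inj) eq_sym in hw *; rewrite hw !eqxx.
  by exists (true, i); rewrite -[(row1, i)]/(embA (true, i)) upperA
    (inj_eq embA_inj) eq_sym in hw *; rewrite hw !eqxx.
case: (row_cases r) => -> //= hw; first by rewrite /lower /= eqxx in hw.
  by exists (false, i); rewrite -[(row1, i)]/(embB (false, i)) lowerB
    (inj_eq embB_inj) eq_sym in hw *; rewrite hw !eqxx orbT.
by exists (true, i); rewrite -[(row2, i)]/(embB (true, i)) lowerB
  (inj_eq embB_inj) eq_sym in hw *; rewrite hw !eqxx orbT.
Qed.

Lemma stack_edge_sym a b : symmetric (stack_edge a b).
Proof.
move=> w1 w2; rewrite !stack_edgeE eq_sym; congr (_ && _); congr (_ || _).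
  by apply/eqP/eqP => ->; rewrite upperK.
by apply/eqP/eqP => ->; rewrite lowerK.
Qed.

Lemma stack_connect_sym a b : connect_sym (stack_edge a b).
Proof. exact: sym_connect_sym (stack_edge_sym a b). Qed.

(** Each outer vertex is fixed by [upper a] or by [lower b], hence is an end of a dihedral orbit,
    and an orbit has at most two ends. So the vertex picked in [stackG] is the only candidate. *)
Lemma stack_outer a b (u v w : vtx n) :
    connect (stack_edge a b) (embO u) (embO v) ->
    connect (stack_edge a b) (embO u) (embO w) ->
  v != u -> w != u -> v = w.
Proof.
have outer v' : upper a (embO v') = embO v' \/ lower b (embO v') = embO v'.
  by case: v' => -[] i; [left|right].
have edge w1 w2 : stack_edge a b w1 w2 -> w2 = upper a w1 \/ w2 = lower b w1.
  by rewrite stack_edgeE => /andP[_ /orP[]/eqP->]; [left|right].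
move=> uv uw vu wu; apply: embO_inj; move: vu wu.
rewrite -!(inj_eq embO_inj) => vu wu.
case: (outer u) => hu; last first.
  by apply: (dihedral_ends (@upperK a) (@lowerK b) edge hu _ _ uv uw vu wu).
have edge' w1 w2 : stack_edge a b w1 w2 -> w2 = lower b w1 \/ w2 = upper a w1.
  by move/edge => []; [right|left].
apply: (dihedral_ends (@lowerK b) (@upperK a) edge' hu _ _ uv uw vu wu).
  by case: (outer v); [right|left].
by case: (outer w); [right|left].
Qed.

Lemma stackG_connect a b v :
  connect (stack_edge a b) (embO v) (embO (stackG a b v)).
Proof. by rewrite ffunE; case: pickP => [u /andP[]|] //=. Qed.

Lemma stackG_eq a b u v : u != v ->
  connect (stack_edge a b) (embO v) (embO u) -> stackG a b v = u.
Proof.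
move=> uv vu; rewrite ffunE; case: pickP => [u' /andP[u'v vu']|/(_ u)] /=.
  exact: stack_outer vu' vu u'v uv.
by rewrite uv vu.
Qed.

Lemma stackG_diagram a b : is_diagram (stackG a b).
Proof.
apply/forallP => v; apply/eqP; set u := stackG a b v.
have [uv|uv] := eqVneq u v; first by rewrite -/u uv.
by apply: stackG_eq; rewrite 1?eq_sym // stack_connect_sym stackG_connect.
Qed.

Definition dcomp a b : diagram n := Sub (stackG a b) (stackG_diagram a b).

(** * Labellings of the vertices by booleans *)

Definition side f g (v : vtx n) := if v.1 then g v.2 else f v.2.

(* [compat d f g] is the entry at (f, g) of the tensor of [d] acting on the
   [n]-th tensor power of a space with a basis indexed by [bool]. *)
Definition compat (d : {ffun vtx n -> vtx n}) f g :=
  [forall v, side f g (d v) == side f g v].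

Lemma compatP (d : {ffun vtx n -> vtx n}) f g :
  reflect (forall v, side f g (d v) = side f g v) (compat d f g).
Proof. exact: 'forall_eqP. Qed.

Definition lab f h g (w : svtx n) :=
  if w.1 == row0 then f w.2 else if w.1 == row1 then h w.2 else g w.2.

Lemma labA f h g v : lab f h g (embA v) = side f h v.
Proof. by case: v => -[]. Qed.
Lemma labB f h g v : lab f h g (embB v) = side h g v.
Proof. by case: v => -[]. Qed.
Lemma labO f h g v : lab f h g (embO v) = side f g v.
Proof. by case: v => -[]. Qed.

Lemma compat_lab a b f h g :
  reflect (forall w1 w2, connect (stack_edge a b) w1 w2 -> lab f h g w1 = lab f h g w2)
    (compat (val a) f h && compat (val b) h g).
Proof.
apply: (iffP andP) => [[/compatP ha /compatP hb] w1 w2|hw]; last first.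
  split; apply/compatP => v.
    have [->//|hv] := eqVneq (val a v) v; rewrite -!(labA f h g); apply/esym/hw.
    by apply: connect1; rewrite stack_edgeE upperA eqxx (inj_eq embA_inj) eq_sym hv.
  have [->//|hv] := eqVneq (val b v) v; rewrite -!(labB f h g); apply/esym/hw.
  by apply: connect1; rewrite stack_edgeE lowerB eqxx (inj_eq embB_inj) eq_sym hv orbT.
case/connectP=> p; elim: p w1 => [w1 _ -> //|w p IHp w1 /= /andP[e hp] hl].
rewrite -(IHp w hp hl); case/existsP: e => v /orP[] /andP[/andP[_ /eqP<-] /eqP<-].
  by rewrite !labA ha.
by rewrite !labB hb.
Qed.

Definition loop_roots a b : {set svtx n} :=
  [set w : svtx n | (w.1 == row1) && (fingraph.root (stack_edge a b) w == w)
    && [forall w', connect (stack_edge a b) w w' ==> (w'.1 == row1)]].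

Section Extend.
Variables (a b : diagram n) (f g : {ffun 'I_n -> bool}) (X : {set svtx n}).

(** A component that meets the outer rows takes its label from there; a component inside the middle
    row is labelled by whether its root lies in [X]. Thus the subsets of [loop_roots] parametrise
    the fillings of the middle row. *)
Definition spread (w : svtx n) : bool :=
  if [pick u | connect (stack_edge a b) w (embO u)] is Some u then side f g u
  else fingraph.root (stack_edge a b) w \in X.

Definition middle : {ffun 'I_n -> bool} := [ffun i => spread (row1, i)].

Lemma spread_connect w1 w2 :
  connect (stack_edge a b) w1 w2 -> spread w1 = spread w2.
Proof.
move=> h12; rewrite /spread.
rewrite (eq_pick (Q := fun u => connect (stack_edge a b) w2 (embO u))); last first.
  by move=> u; rewrite (same_connect (@stack_connect_sym a b) h12).
case: pickP => // _.
by have /(fingraph.rootP (@stack_connect_sym a b)) -> := h12.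
Qed.

Hypothesis fg : compat (stackG a b) f g.

Lemma spread_outer v : spread (embO v) = side f g v.
Proof.
rewrite /spread; case: pickP => [u vu|/(_ v)]; last by rewrite connect0.
have [->//|uv] := eqVneq u v.
by rewrite -(stackG_eq uv vu) (compatP _ _ _ fg).
Qed.

Lemma lab_middle w : lab f middle g w = spread w.
Proof.
case: w => r i; case: (row_cases r) => ->.
- by rewrite -[(row0, i)]/(embO (false, i)) spread_outer labO.
- by rewrite /lab /= ffunE.
- by rewrite -[(row2, i)]/(embO (true, i)) spread_outer labO.
Qed.

Lemma middle_compat : compat (val a) f middle && compat (val b) middle g.
Proof. by apply/compat_lab => w1 w2 h; rewrite !lab_middle (spread_connect h). Qed.

End Extend.

(** An entry of the product of the matrices of [a] and [b]: each component inside the middle row has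
    two free labels, all other labels are forced. So [compat] represents the diagrams at parameter
    2. *)
Lemma compat_count a b f g :
  #|[set h | compat (val a) f h && compat (val b) h g]|
  = if compat (val (dcomp a b)) f g then 2 ^ loops a b else 0.
Proof.
rewrite /dcomp /=; case: ifPn => fg; last first.
  apply: eq_card0 => h; rewrite inE; apply/negbTE; apply: contra fg.
  move/compat_lab => hl; apply/compatP => v; rewrite -!(labO f h g).
  by apply/esym/hl/stackG_connect.
rewrite -[loops a b]/#|loop_roots a b| -card_powerset.
have no_outer w : w \in loop_roots a b ->
    [pick u | connect (stack_edge a b) w (embO u)] = None.
  rewrite inE => /andP[_ /forallP hw]; case: pickP => // u.
  by move/(implyP (hw _)); case: u => -[].
rewrite -(card_in_imset (f := middle a b f g)); last first.
  move=> X Y; rewrite !powersetE => /subsetP hX /subsetP hY eXY; apply/setP => w.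
  have [hw|hw] := boolP (w \in loop_roots a b); last first.
    by rewrite (contraNF (hX w) hw) (contraNF (hY w) hw).
  have := lab_middle X fg w; rewrite eXY lab_middle // /spread no_outer //.
  by move: hw; rewrite inE => /andP[/andP[_ /eqP->] _].
congr #|pred_of_set _|; apply/setP => h; apply/idP/imsetP => [|[X hX ->]]; last first.
  by rewrite inE middle_compat.
rewrite inE => /compat_lab hh.
exists [set w in loop_roots a b | lab f h g w].
  by rewrite powersetE; apply/subsetP => w; rewrite inE => /andP[].
apply/ffunP => i; rewrite ffunE /spread; case: pickP => [u hu|hno].
  by rewrite -(labO f h g) -(hh _ _ hu).
set w := (row1, i); set r := fingraph.root _ _.
have hr : connect (stack_edge a b) w r := connect_root _ _.
have mid w' : connect (stack_edge a b) w w' -> w'.1 == row1.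
  case: w' => r' j; case: (row_cases r') => -> // hw'.
    by have := hno (false, j); rewrite hw'.
  by have := hno (true, j); rewrite hw'.
rewrite inE -(hh _ _ hr) andb_idl // => _; rewrite inE mid //=.
rewrite (root_root (@stack_connect_sym a b)) eqxx /=.
apply/forallP => w'; apply/implyP => hw'; apply: mid.
exact: connect_trans hr hw'.
Qed.

End Stack.

(** * The diagram algebra *)

Section Operators.
Variable n : nat.
Implicit Types (a b c d : diagram n) (f g h : {ffun 'I_n -> bool}).

Definition op d (phi : {ffun 'I_n -> bool} -> nat) f : nat :=
  \sum_g compat (val d) f g * phi g.

Lemma op_ext d phi psi : phi =1 psi -> op d phi =1 op d psi.
Proof. by move=> e f; apply: eq_bigr => g _; rewrite e. Qed.

Lemma op_scale d m phi f : op d (fun g => m * phi g) f = m * op d phi f.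
Proof. by rewrite /op big_distrr /=; apply: eq_bigr => g _; rewrite mulnCA. Qed.

Lemma op_comp a b phi f :
  op a (op b phi) f = 2 ^ loops a b * op (dcomp a b) phi f.
Proof.
rewrite /op; under eq_bigr do rewrite big_distrr /=.
rewrite exchange_big /= big_distrr; apply: eq_bigr => g _ /=.
under eq_bigr do rewrite mulnA mulnb.
rewrite -big_distrl /= mulnA; congr (_ * _).
transitivity #|[set h | compat (val a) f h && compat (val b) h g]|.
  by rewrite -sum1dep_card [RHS]big_mkcond; apply: eq_bigr => h _; case: ifP.
by rewrite compat_count; case: ifP => _; rewrite ?muln1 ?muln0.
Qed.

Lemma op_delta d f g : op d (fun h => h == g) f = compat (val d) f g.
Proof.
rewrite /op (bigD1 g) //= eqxx muln1 big1 ?addn0 // => h /negbTE ->.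
exact: muln0.
Qed.

Lemma compat_const d t : compat (val d) [ffun=> t] [ffun=> t].
Proof. by apply/compatP => v; rewrite /side !ffunE !if_same. Qed.

(** The test labelling is the indicator function of the edge [{v, c v}]: it is compatible with [c],
    so [c'] must preserve it. *)
Lemma compat_mem c c' (v : vtx n) : (forall f g, compat (val c) f g -> compat (val c') f g) ->
  val c' v \in [:: v; val c v].
Proof.
move=> h; pose L := [pred w | w \in [:: v; val c v]].
have sideL w : side [ffun i => L (false, i)] [ffun i => L (true, i)] w = L w.
  by case: w => -[] i; rewrite /side /= ffunE.
have /compatP/(_ v) : compat (val c') [ffun i => L (false, i)] [ffun i => L (true, i)].
  apply/h/compatP => w; rewrite !sideL /= !inE (inj_eq (inv_inj (@diagramK n c))).
  have -> : (w == val c v) = (val c w == v) by rewrite -(inj_eq (inv_inj (@diagramK n c))) diagramK.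
  exact: orbC.
by rewrite !sideL /= !inE eqxx => ->.
Qed.

Lemma compat_inj c c' : (forall f g, compat (val c) f g = compat (val c') f g) -> c = c'.
Proof.
move=> h; apply/val_inj/ffunP => v.
have h1 : val c' v \in [:: v; val c v] by apply: compat_mem => f g; rewrite h.
have h2 : val c v \in [:: v; val c' v] by apply: compat_mem => f g; rewrite h.
by move: h1 h2; rewrite !inE => /orP[]/eqP-> // /orP[]/eqP->.
Qed.

(** Constant labels are compatible with every diagram, so their entry gives the scalar; the other
    entries then give the diagram. One matrix identity thus yields both the diagram and its number
    of loops. *)
Lemma compat_scale_inj k k' c c' :
    (forall f g, 2 ^ k * compat (val c) f g = 2 ^ k' * compat (val c') f g) ->
  k = k' /\ c = c'.
Proof.
move=> h.
have hk : 2 ^ k = 2 ^ k'.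
  by have := h [ffun=> true] [ffun=> true]; rewrite !compat_const !muln1.
split; first by apply/eqP; rewrite -(eqn_exp2l _ _ (ltnSn 1)) hk.
apply: compat_inj => f g; have /eqP := h f g.
rewrite hk eqn_pmul2l ?expn_gt0 //.
by do 2 case: compat.
Qed.

Lemma op_inj k k' c c' :
    (forall phi f, 2 ^ k * op c phi f = 2 ^ k' * op c' phi f) ->
  k = k' /\ c = c'.
Proof. by move=> h; apply: compat_scale_inj => f g; rewrite -!op_delta. Qed.

(** Both equalities are the associativity of the composition of operators, read through [op_inj]. *)
Lemma dcompA a b c :
  loops a b + loops (dcomp a b) c = loops b c + loops a (dcomp b c) /\
  dcomp (dcomp a b) c = dcomp a (dcomp b c).
Proof.
apply: op_inj => phi f.
rewrite expnD -mulnA -op_comp -op_comp expnD -mulnA -op_comp -op_scale.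
by apply: op_ext => g; apply: op_comp.
Qed.

Fact perm_diagram_subproof (s : 'S_n) :
  is_diagram [ffun v : vtx n => if v.1 then (false, s^-1%g v.2) else (true, s v.2)].
Proof.
by apply/forallP => -[[] i]; rewrite !ffunE /= ?permK ?permKV.
Qed.
Definition perm_diagram s : diagram n := Sub _ (perm_diagram_subproof s).

Lemma op_perm s phi f : op (perm_diagram s) phi f = phi [ffun i => f (s^-1%g i)].
Proof.
rewrite /op (bigD1 [ffun i => f (s^-1%g i)]) //= [X in X * _](_ : _ = 1) ?mul1n; last first.
  apply/eqP; rewrite eqb1; apply/compatP => -[[] i]; rewrite !ffunE /side /= !ffunE //.
  by rewrite permK.
rewrite big1 ?addn0 // => g; case: compatP => // h /eqP[].
by apply/ffunP => i; rewrite !ffunE; have := h (true, i); rewrite /side !ffunE /=.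
Qed.

Lemma op_perm1 phi f : op (perm_diagram 1) phi f = phi f.
Proof.
by rewrite op_perm; congr phi; apply/ffunP => i; rewrite ffunE invg1 perm1.
Qed.

Lemma dcomp1d d : loops (perm_diagram 1) d = 0 /\ dcomp (perm_diagram 1) d = d.
Proof. by apply: op_inj => phi f; rewrite -op_comp op_perm1 mul1n. Qed.

Lemma dcompd1 d : loops d (perm_diagram 1) = 0 /\ dcomp d (perm_diagram 1) = d.
Proof.
apply: op_inj => phi f; rewrite -op_comp mul1n.
exact: op_ext (op_perm1 _) _.
Qed.

End Operators.

(** The type is indexed by [x] so that its canonical ring structure can depend on [x]; values in
    [F^o] supply the vector space structure. *)
Definition rook_brauer (F : fieldType) (n : nat) (x : F) : Type := {ffun diagram n -> F^o}.

Section RookBrauer.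
Local Open Scope ring_scope.
Variables (F : fieldType) (n : nat) (x : F).
Local Notation A := (rook_brauer n x).

HB.instance Definition _ := Vector.copy A {ffun diagram n -> F^o}.

Definition basis (d : diagram n) : A := [ffun c => (c == d)%:R].

Lemma rb_sum (u : A) : u = \sum_d u d *: basis d.
Proof.
apply/ffunP => c; rewrite sum_ffunE (bigD1 c) //= !ffunE eqxx big1 ?addr0.
  by rewrite -[LHS]mulr1.
by move=> d; rewrite !ffunE eq_sym => /negbTE ->; apply: mulr0.
Qed.

Definition rb_mul (u v : A) : A := amul x u v.

Lemma rb_mulE u v :
  rb_mul u v = \sum_a \sum_b (u a * v b * x ^+ loops a b) *: basis (dcomp a b).
Proof.
apply/ffunP => c; rewrite ffunE sum_ffunE; apply: eq_bigr => a _.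
rewrite sum_ffunE; apply: eq_bigr => b _; rewrite !ffunE -[stackG a b]/(val (dcomp a b)).
rewrite (inj_eq val_inj) eq_sym; case: ifP => _; first by rewrite -[LHS]mulr1.
by rewrite -[LHS](mulr0 (u a * v b * x ^+ loops a b)).
Qed.

Lemma rb_mul_linearl v : linear (rb_mul ^~ v).
Proof.
move=> k u u'; rewrite !rb_mulE scaler_sumr -big_split /=; apply: eq_bigr => a _.
rewrite scaler_sumr -big_split /=; apply: eq_bigr => b _.
by rewrite scalerA -scalerDl !mulrA -!mulrDl !ffunE.
Qed.

Lemma rb_mul_linearr u : linear (rb_mul u).
Proof.
move=> k v v'; rewrite !rb_mulE scaler_sumr -big_split /=; apply: eq_bigr => a _.
rewrite scaler_sumr -big_split /=; apply: eq_bigr => b _.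
rewrite scalerA -scalerDl !ffunE; congr (_ *: _).
by rewrite [k *: v b]/(k * v b) mulrDr mulrDl mulrCA !mulrA.
Qed.

Lemma basisE a c : basis a c = (c == a)%:R.
Proof. exact: ffunE. Qed.

Lemma rb_mul_basis a b :
  rb_mul (basis a) (basis b) = x ^+ loops a b *: basis (dcomp a b).
Proof.
rewrite rb_mulE (bigD1 a) //=.
rewrite [X in X + _](bigD1 b) //=.
rewrite [X in _ + X]big1 ?addr0 => [|c /negbTE hc]; last first.
  by apply: big1 => d _; rewrite [basis a c]basisE hc !mul0r scale0r.
rewrite [X in _ + X]big1 ?addr0 => [|d /negbTE hd]; last first.
  by rewrite [basis b d]basisE hd mulr0 mul0r scale0r.
by rewrite [basis a a]basisE [basis b b]basisE !eqxx !mul1r.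
Qed.

Lemma linear_split (u : A -> A) : linear u ->
  (forall v w, u (v + w) = u v + u w) /\ (forall k v, u (k *: v) = k *: u v).
Proof.
move=> hu; pose U := GRing.isLinear.Build F A A *:%R u hu.
pose lu : {linear A -> A} := HB.pack u U.
by split=> [v w|k v]; [exact: (raddfD lu)|exact: (linearZ_LR lu)].
Qed.

Lemma rb_mulDl : left_distributive rb_mul +%R.
Proof. by move=> u u' v; have [-> _] := linear_split (rb_mul_linearl v). Qed.
Lemma rb_mulDr : right_distributive rb_mul +%R.
Proof. by move=> u v v'; have [-> _] := linear_split (rb_mul_linearr u). Qed.
Lemma rb_mulZl k u v : k *: rb_mul u v = rb_mul (k *: u) v.
Proof. by have [_ ->] := linear_split (rb_mul_linearl v). Qed.
Lemma rb_mulZr k u v : k *: rb_mul u v = rb_mul u (k *: v).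
Proof. by have [_ ->] := linear_split (rb_mul_linearr u). Qed.

Lemma rb_ind (u v : A -> A) : linear u -> linear v ->
  (forall d, u (basis d) = v (basis d)) -> u =1 v.
Proof.
move=> hu hv h w; pose U := GRing.isLinear.Build F A A *:%R u hu.
pose V := GRing.isLinear.Build F A A *:%R v hv.
pose lu : {linear A -> A} := HB.pack u U; pose lv : {linear A -> A} := HB.pack v V.
rewrite -[u]/(lu : A -> A) -[v]/(lv : A -> A) [w]rb_sum !linear_sum.
by apply: eq_bigr => d _; rewrite !linearZ /= h.
Qed.

Lemma rb_mulA : associative rb_mul.
Proof.
move=> u v w; move: u; apply: rb_ind => [k u u'|k u u'|a].
- by rewrite rb_mul_linearl.
- by rewrite !rb_mul_linearl.
move: v; apply: rb_ind => [k v v'|k v v'|b].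
- by rewrite rb_mul_linearl rb_mul_linearr.
- by rewrite rb_mul_linearr rb_mul_linearl.
move: w; apply: rb_ind => [k w w'|k w w'|c].
- by rewrite !rb_mul_linearr.
- by rewrite rb_mul_linearr.
rewrite !rb_mul_basis -rb_mulZr -rb_mulZl !rb_mul_basis !scalerA -!exprD.
by have [-> ->] := dcompA a b c.
Qed.

Lemma rb_mul1 : left_id (basis (perm_diagram 1)) rb_mul.
Proof.
apply: rb_ind => [k u u'|//|d]; first by rewrite rb_mul_linearr.
by rewrite rb_mul_basis; have [-> ->] := dcomp1d d; rewrite scale1r.
Qed.

Lemma rb_mulr1 : right_id (basis (perm_diagram 1)) rb_mul.
Proof.
apply: rb_ind => [k u u'|//|d]; first by rewrite rb_mul_linearl.
by rewrite rb_mul_basis; have [-> ->] := dcompd1 d; rewrite scale1r.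
Qed.

Lemma basis_neq0 d : basis d != 0.
Proof.
apply/eqP => /ffunP/(_ d); rewrite !ffunE eqxx => /eqP.
by rewrite oner_eq0.
Qed.

HB.instance Definition _ := GRing.Zmodule_isNzRing.Build A rb_mulA rb_mul1 rb_mulr1
  rb_mulDl rb_mulDr (basis_neq0 _).
HB.instance Definition _ := GRing.Lmodule_isLalgebra.Build F A rb_mulZl.
HB.instance Definition _ := GRing.Lalgebra_isAlgebra.Build F A rb_mulZr.

Lemma mul_basis a b : basis a * basis b = x ^+ loops a b *: basis (dcomp a b) :> A.
Proof. exact: rb_mul_basis. Qed.

End RookBrauer.

(** * Word identities on two-label tensors *)

Section Diagrams.
Variable n : nat.
Implicit Types (a b c d : diagram n) (f g h : {ffun 'I_n -> bool}).

Definition mirror (v : vtx n) : vtx n := (~~ v.1, v.2).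

Lemma mirrorK : involutive mirror.
Proof. by case=> t i; rewrite /mirror /= negbK. Qed.

Fact flip_subproof d : is_diagram [ffun v => mirror (val d (mirror v))].
Proof. by apply/forallP => v; rewrite !ffunE mirrorK diagramK mirrorK. Qed.
Definition flip d : diagram n := Sub _ (flip_subproof d).

Lemma flipE d v : val (flip d) v = mirror (val d (mirror v)).
Proof. by rewrite ffunE. Qed.

Lemma flipK : involutive flip.
Proof. by move=> d; apply/val_inj/ffunP => v; rewrite !flipE !mirrorK. Qed.

Lemma compat_flip d f g : compat (val (flip d)) f g = compat (val d) g f.
Proof.
have sideE v : side f g v = side g f (mirror v) by case: v => -[].
apply/compatP/compatP => h v.
  by have := h (mirror v); rewrite !sideE flipE !mirrorK.
by rewrite !sideE flipE mirrorK.
Qed.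

(** On matrices [flip] is transposition, which reverses products. The resulting anti-automorphism
    turns each left-hand relation below into a right-hand one. *)
Lemma dcomp_flip a b :
  loops (flip b) (flip a) = loops a b /\ dcomp (flip b) (flip a) = flip (dcomp a b).
Proof.
apply: compat_scale_inj => f g; rewrite compat_flip.
have count a' b' f' g' : 2 ^ loops a' b' * compat (val (dcomp a' b')) f' g' =
    #|[set h | compat (val a') f' h && compat (val b') h g']|.
  by rewrite compat_count; case: ifP; rewrite ?muln1 ?muln0.
by rewrite !count; apply: eq_card => h; rewrite !inE !compat_flip andbC.
Qed.

Lemma op_word (w : seq (diagram n)) :
  exists k c, (forall phi f, foldr (@op n) phi w f = 2 ^ k * op c phi f) /\
    forall (F : fieldType) (x : F),
      (\prod_(d <- w) basis x d = x ^+ k *: basis x c)%R.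
Proof.
elim: w => [|a w [k [c [IH1 IH2]]]].
  exists 0, (perm_diagram 1); split=> [phi f|F x]; first by rewrite op_perm1 mul1n.
  by rewrite big_nil scale1r.
exists (k + loops a c), (dcomp a c); split=> [phi f|F x].
  by rewrite /= (op_ext _ (IH1 phi)) op_scale op_comp expnD mulnA.
by rewrite big_cons IH2 -scalerAr mul_basis scalerA -exprD.
Qed.

(* Since the powers of the parameter are visible on tensors over a
   two-dimensional space, word identities may be checked there. *)
Lemma op_word_eq k (w w' : seq (diagram n)) (F : fieldType) (x : F) :
    (forall phi f, foldr (@op n) phi w f = 2 ^ k * foldr (@op n) phi w' f) ->
  (\prod_(d <- w) basis x d = x ^+ k *: \prod_(d <- w') basis x d)%R.
Proof.
move=> h; have [l [c [hc ->]]] := op_word w; have [l' [c' [hc' ->]]] := op_word w'.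
have [-> ->] : l = k + l' /\ c = c'.
  by apply: op_inj => phi f; rewrite -hc h hc' expnD mulnA.
by rewrite scalerA -exprD.
Qed.

Definition upd f i t : {ffun 'I_n -> bool} := [ffun k => if k == i then t else f k].

Fact cup_subproof i j : is_diagram [ffun v : vtx n =>
  if v.2 == i then (v.1, j) else if v.2 == j then (v.1, i) else mirror v].
Proof.
apply/forallP => v; rewrite !ffunE; case: (eqVneq v.2 i) => /= [hi|hi].
  by case: (eqVneq j i) => /= [->|_]; rewrite ?eqxx -hi -surjective_pairing.
case: (eqVneq v.2 j) => /= [hj|hj]; first by rewrite eqxx -hj -surjective_pairing.
by rewrite (negbTE hi) (negbTE hj) mirrorK.
Qed.

(* [cup i j] joins [i] with [j] in both rows; [cup i i] isolates [i] in both rows. *)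
Definition cup i j : diagram n := Sub _ (cup_subproof i j).

Lemma cupE i j v : val (cup i j) v =
  if v.2 == i then (v.1, j) else if v.2 == j then (v.1, i) else mirror v.
Proof. by rewrite ffunE. Qed.

Lemma flip_cup i j : flip (cup i j) = cup i j.
Proof.
apply/val_inj/ffunP => v; rewrite flipE !cupE /=.
by do 2?case: ifP => //; rewrite /mirror /= negbK.
Qed.

Lemma cupC i j : cup i j = cup j i.
Proof.
apply/val_inj/ffunP => v; rewrite !cupE.
by case: (eqVneq v.2 i) => [->|//]; case: (eqVneq i j) => [->|].
Qed.

Lemma flip_perm s : flip (perm_diagram s) = perm_diagram s^-1.
Proof.
apply/val_inj/ffunP => v; rewrite flipE !ffunE.
by case: v => -[] i; rewrite /mirror //= invgK.
Qed.

(** The edge in the top row imposes [f i = f j]; the edge in the bottom row sums over the common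
    label of [i] and [j]. *)
Lemma op_cup i j phi f : op (cup i j) phi f =
  (f i == f j) * (phi (upd (upd f i true) j true) + phi (upd (upd f i false) j false)).
Proof.
have hc g : compat (val (cup i j)) f g = (f i == f j) &&
    ((g == upd (upd f i true) j true) || (g == upd (upd f i false) j false)).
  apply/compatP/idP => [h|/andP[/eqP fij hg] [t k]].
    have := h (false, i); rewrite cupE /= eqxx /side /= => ->; rewrite eqxx /=.
    have := h (true, i); rewrite cupE /= eqxx /side /= => gij.
    have gE : g = upd (upd f i (g i)) j (g i).
      apply/ffunP => k; rewrite !ffunE.
      have [->//|kj] := eqVneq k j; have [->//|ki] := eqVneq k i.
      by have := h (false, k); rewrite cupE /= (negbTE ki) (negbTE kj).
    by rewrite gE; case: (g i); rewrite eqxx ?orbT.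
  have {hg} [u ->] : exists u, g = upd (upd f i u) j u.
    by case/orP: hg => /eqP ->; [exists true|exists false].
  rewrite cupE /side /=.
  have [->|ki] /= := eqVneq k i; first by case: t; rewrite ?ffunE ?eqxx ?if_same ?fij.
  have [->|kj] /= := eqVneq k j.
    by case: t; rewrite ?ffunE ?eqxx ?if_same ?fij.
  by case: t; rewrite ?ffunE (negbTE ki) ?(negbTE kj).
rewrite /op; under eq_bigr do rewrite hc.
case: (f i == f j) => /=; last by rewrite mul0n big1 // => g _; rewrite mul0n.
have neq : upd (upd f i true) j true != upd (upd f i false) j false.
  by apply/eqP => /ffunP/(_ j); rewrite !ffunE eqxx.
rewrite mul1n (bigD1 (upd (upd f i true) j true)) //= eqxx mul1n; congr (_ + _).
rewrite (bigD1 (upd (upd f i false) j false)) 1?eq_sym //= eqxx orbT mul1n.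
rewrite big1 ?addn0 // => g /andP[/negbTE -> /negbTE ->]; exact: mul0n.
Qed.

Lemma op_dot i phi f : op (cup i i) phi f = phi (upd f i true) + phi (upd f i false).
Proof.
rewrite op_cup eqxx mul1n.
by congr (phi _ + phi _); apply/ffunP => k; rewrite !ffunE; case: eqP.
Qed.

End Diagrams.

(** * Relations between diagrams *)

(** The label of an isolated vertex is unconstrained; the converse implication restores the old
    label. *)
Lemma compat_upd n (d : diagram n) i t (f g : {ffun 'I_n -> bool}) : val d (false, i) = (false, i) ->
  compat (val d) (upd f i t) g = compat (val d) f g.
Proof.
move=> di; have gen u f' : compat (val d) f' g -> compat (val d) (upd f' i u) g.
  move=> /compatP h; apply/compatP => v.
  have [->|vi] := eqVneq v (false, i); first by rewrite di.
  have dvi : val d v != (false, i) by rewrite -di (inj_eq (inv_inj (@diagramK n d))).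
  have sideE w : w != (false, i) -> side (upd f' i u) g w = side f' g w.
    by case: w => -[] k //; rewrite xpair_eqE /= /side ffunE /= => /negbTE->.
  by rewrite !sideE.
apply/idP/idP; last exact: gen.
move/(gen (f i)); congr compat; apply/ffunP => k; rewrite !ffunE.
by case: eqP => // ->.
Qed.

Lemma compat_upd2 n (d : diagram n) i j t (f g : {ffun 'I_n -> bool}) : val d (false, i) = (false, j) ->
  f i = f j -> compat (val d) (upd (upd f i t) j t) g = compat (val d) f g.
Proof.
move=> di; have dj : val d (false, j) = (false, i) by rewrite -di diagramK.
have gen u f' : compat (val d) f' g -> compat (val d) (upd (upd f' i u) j u) g.
  move=> /compatP h; apply/compatP => v.
  have [->|vi] := eqVneq v (false, i); first by rewrite di /side !ffunE !eqxx !if_same.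
  have [->|vj] := eqVneq v (false, j); first by rewrite dj /side !ffunE !eqxx !if_same.
  have dvi : val d v != (false, i) by rewrite -dj (inj_eq (inv_inj (@diagramK n d))).
  have dvj : val d v != (false, j) by rewrite -di (inj_eq (inv_inj (@diagramK n d))).
  have sideE w : w != (false, i) -> w != (false, j) ->
      side (upd (upd f' i u) j u) g w = side f' g w.
    case: w => -[] k //; rewrite !xpair_eqE /= /side !ffunE /= => /negbTE ki /negbTE kj.
    by rewrite ki kj.
  by rewrite !sideE.
move=> fij; apply/idP/idP; last exact: gen.
move/(gen (f i)); congr compat; apply/ffunP => k; rewrite !ffunE.
by case: eqP => [->//|_]; case: eqP => [->|].
Qed.

Local Open Scope ring_scope.

Section Relations.
Variables (F : fieldType) (n : nat) (x : F).
Local Notation A := (rook_brauer n x).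

Definition rho (s : 'S_n) : A := basis x (perm_diagram s).
Definition ecup i j : A := basis x (cup i j).
Definition dot i : A := x^-1 *: ecup i i.

Lemma word_rel k (w w' : seq (diagram n)) (u v : A) :
    u = \prod_(d <- w) basis x d -> v = \prod_(d <- w') basis x d ->
    (forall phi f, foldr (@op n) phi w f = (2 ^ k * foldr (@op n) phi w' f)%N) ->
  u = x ^+ k *: v.
Proof. by move=> -> ->; apply: op_word_eq. Qed.

Lemma word_rel0 (w w' : seq (diagram n)) (u v : A) :
    u = \prod_(d <- w) basis x d -> v = \prod_(d <- w') basis x d ->
    (forall phi f, foldr (@op n) phi w f = foldr (@op n) phi w' f) ->
  u = v.
Proof.
by move=> hu hv h; rewrite (word_rel (k := 0) hu hv) ?scale1r // => phi f; rewrite mul1n.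
Qed.

Lemma prod1 (d : diagram n) : basis x d = \prod_(c <- [:: d]) basis x c.
Proof. by rewrite big_seq1. Qed.
Lemma prod2 (c d : diagram n) : basis x c * basis x d = \prod_(c <- [:: c; d]) basis x c.
Proof. by rewrite big_cons big_seq1. Qed.
Lemma prod3 (b c d : diagram n) :
  basis x b * basis x c * basis x d = \prod_(c <- [:: b; c; d]) basis x c.
Proof. by rewrite !big_cons big_nil mulr1 mulrA. Qed.

Lemma rho1 : rho 1 = 1. Proof. by []. Qed.

Lemma rhoM s t : rho s * rho t = rho (s * t).
Proof.
apply: word_rel0 (prod2 _ _) (prod1 _) _ => phi f; rewrite /= !op_perm.
by congr phi; apply/ffunP => i; rewrite !ffunE invMg permM.
Qed.

Lemma ecupC i j : ecup i j = ecup j i.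
Proof. by rewrite /ecup cupC. Qed.

Lemma ecup_rho i j s : ecup i j * rho s = rho s * ecup (s i) (s j).
Proof.
apply: word_rel0 (prod2 _ _) (prod2 _ _) _ => phi f; rewrite /= !op_perm !op_cup !op_perm.
rewrite !ffunE !permK; congr (_ * (phi _ + phi _))%N; apply/ffunP => k; rewrite !ffunE.
  by rewrite -(inj_eq (@perm_inj _ s) _ i) -(inj_eq (@perm_inj _ s) _ j) permKV.
by rewrite -(inj_eq (@perm_inj _ s) _ i) -(inj_eq (@perm_inj _ s) _ j) permKV.
Qed.

Lemma dot_rho i s : dot i * rho s = rho s * dot (s i).
Proof. by rewrite -scalerAl ecup_rho scalerAr. Qed.

Lemma ecup_tpermr i j : ecup i j * rho (tperm i j) = ecup i j.
Proof.
apply: word_rel0 (prod2 _ _) (prod1 _) _ => phi f; rewrite /= !op_cup !op_perm.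
congr (_ * (phi _ + phi _))%N; apply/ffunP => k; rewrite !ffunE tpermV.
  by case: tpermP => [->|->|//]; rewrite !eqxx !if_same.
by case: tpermP => [->|->|//]; rewrite !eqxx !if_same.
Qed.

Lemma dot_ecup_comm k i j : k != i -> k != j -> dot k * ecup i j = ecup i j * dot k.
Proof.
move=> ki kj; rewrite -scalerAl -scalerAr; congr (_ *: _).
apply: word_rel0 (prod2 _ _) (prod2 _ _) _ => phi f; rewrite /= op_dot [op _ _ f]op_cup !op_dot !op_cup.
rewrite !ffunE !(eq_sym _ k) (negbTE ki) (negbTE kj) -mulnDr; congr (_ * _)%N.
rewrite addnACA; congr (phi _ + phi _ + (phi _ + phi _))%N;
  apply/ffunP => l; rewrite !ffunE;
  by case: (eqVneq l k) => [->|//]; rewrite (negbTE ki) (negbTE kj).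
Qed.

Lemma dotC i j : dot i * dot j = dot j * dot i.
Proof.
have [->//|ij] := eqVneq i j.
by rewrite -[dot j]/(x^-1 *: ecup j j) -[RHS]scalerAl -[LHS]scalerAr dot_ecup_comm.
Qed.

Lemma ecup_dotr i j : ecup i j * dot i = ecup i j * dot j.
Proof.
have [->//|ij] := eqVneq i j.
rewrite -!scalerAr; congr (_ *: _).
apply: word_rel0 (prod2 _ _) (prod2 _ _) _ => phi f; rewrite /= ![op _ _ f]op_cup !op_dot.
rewrite addnACA; congr (_ * (phi _ + phi _ + (phi _ + phi _)))%N;
  apply/ffunP => l; rewrite !ffunE;
  by case: (eqVneq l i) => [->|_]; rewrite ?(negbTE ij) //; case: eqP.
Qed.

Lemma ecup_comm i j k l : i != k -> i != l -> j != k -> j != l ->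
  ecup i j * ecup k l = ecup k l * ecup i j.
Proof.
move=> ik il jk jl.
apply: word_rel0 (prod2 _ _) (prod2 _ _) _ => phi f; rewrite /= !op_cup !ffunE.
rewrite !(eq_sym _ i) !(eq_sym _ j) (negbTE ik) (negbTE il) (negbTE jk) (negbTE jl).
rewrite -!mulnDr !mulnA [((f i == f j) * _)%N]mulnC; congr (_ * _)%N.
rewrite addnACA; congr (phi _ + phi _ + (phi _ + phi _))%N;
  apply/ffunP => m; rewrite !ffunE;
  (case: (eqVneq m i) => [->|_]; rewrite ?(negbTE ik) ?(negbTE il) //);
  by case: (eqVneq m j) => [->|//]; rewrite ?(negbTE jk) ?(negbTE jl).
Qed.

(** The strand starting at [i] runs through both contractions in the middle row and comes out at
    [k], closing no loop. *)
Lemma ecup_ecup i j k : i != j -> j != k -> i != k ->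
  ecup j k * ecup i j = ecup j k * rho (tperm i k).
Proof.
move=> ij jk ik.
apply: word_rel0 (prod2 _ _) (prod2 _ _) _ => phi f; rewrite /= !op_cup !op_perm tpermV.
rewrite !ffunE !eqxx (negbTE ij) (negbTE ik) (negbTE jk); congr (_ * _)%N.
have swap t u : f i = t -> upd (upd (upd (upd f j t) k t) i u) j u =
    [ffun i0 => upd (upd f j u) k u (tperm i k i0)] :> {ffun 'I_n -> bool}.
  move=> fi; apply/ffunP => l; rewrite !ffunE.
  case: (tpermP i k l) => [->|->|/eqP li /eqP lk].
  - by rewrite !eqxx (negbTE ij).
  - by rewrite eqxx (negbTE ik) (negbTE ij) !(eq_sym k) (negbTE jk) (negbTE ik).
  - by rewrite (negbTE li) (negbTE lk); case: eqP.
by case fi: (f i); rewrite /= !(mul0n, mul1n) ?addn0 ?add0n !(swap _ _ fi).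
Qed.

Lemma ecup_sq i j : i != j -> ecup i j * ecup i j = x *: ecup i j.
Proof.
move=> ij; rewrite -[x in RHS]expr1.
apply: word_rel (prod2 _ _) (prod1 _) _ => phi f; rewrite /= !op_cup !ffunE !eqxx.
rewrite (negbTE ij) !eqxx !mul1n mulnCA; congr (_ * _)%N; rewrite mul2n -addnn.
congr (phi _ + phi _ + (phi _ + phi _))%N; apply/ffunP => k; rewrite !ffunE;
  by do 2?case: eqP.
Qed.

(** Isolating [i] opens the closed loop of [ecup_sq] into a path that still lies in the middle row
    and so counts for one factor [x] as well. *)
Lemma ecup_dot_ecup i j : i != j -> ecup i j * ecup i i * ecup i j = x *: ecup i j.
Proof.
move=> ij; rewrite -[x in RHS]expr1.
apply: word_rel (prod3 _ _ _) (prod1 _) _ => phi f; rewrite /= [op _ _ f]op_cup !op_dot.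
rewrite !op_cup !ffunE !eqxx [j == i]eq_sym (negbTE ij) /=.
rewrite !(mul0n, mul1n) ?addn0 ?add0n mulnCA; congr (_ * _)%N; rewrite mul2n -addnn.
congr (phi _ + phi _ + (phi _ + phi _))%N; apply/ffunP => k; rewrite !ffunE;
  by do 4?case: eqP.
Qed.

Lemma dot_sq i : x != 0 -> dot i * dot i = dot i.
Proof.
move=> x0; rewrite -scalerAl -scalerAr.
have -> : ecup i i * ecup i i = x *: ecup i i.
  rewrite -[x in RHS]expr1; apply: word_rel (prod2 _ _) (prod1 _) _ => phi f.
  rewrite /= op_dot !op_dot mul2n -addnn.
  by congr (phi _ + phi _ + (phi _ + phi _))%N; apply/ffunP => k; rewrite !ffunE; case: eqP.
by rewrite (scalerA x^-1 x) mulVf // scale1r.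
Qed.

Lemma dot_basis (d : diagram n) i : x != 0 -> val d (false, i) = (false, i) -> dot i * basis x d = basis x d.
Proof.
move=> x0 di; rewrite -scalerAl.
have -> : ecup i i * basis x d = x *: basis x d.
  rewrite -[x in RHS]expr1; apply: word_rel (prod2 _ _) (prod1 _) _ => phi f.
  rewrite /= op_dot mul2n -addnn.
  by congr (_ + _)%N; apply: eq_bigr => g _; rewrite compat_upd.
by rewrite scalerA mulVf // scale1r.
Qed.

Lemma ecup_basis (d : diagram n) i j : val d (false, i) = (false, j) -> ecup i j * basis x d = x *: basis x d.
Proof.
move=> di; rewrite -[x in RHS]expr1; apply: word_rel (prod2 _ _) (prod1 _) _ => phi f.
rewrite /= op_cup mul2n -addnn; have [fij|fij] := eqVneq (f i) (f j).
  rewrite mul1n; congr (_ + _)%N; apply: eq_bigr => g _; congr (_ * _)%N.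
    by rewrite (compat_upd2 _ _ di).
  by rewrite (compat_upd2 _ _ di).
rewrite mul0n [op _ _ _]big1 // => g _; case: compatP => // /(_ (false, i)).
by rewrite di /side /= => /esym/eqP; rewrite (negbTE fij).
Qed.

(** * The anti-automorphism exchanging the two rows *)

Definition rb_flip (u : A) : A := [ffun c => u (flip c)].

Lemma rb_flip_linear : linear rb_flip.
Proof. by move=> k u v; apply/ffunP => c; rewrite !ffunE. Qed.

HB.instance Definition _ := GRing.isLinear.Build F A A *:%R rb_flip rb_flip_linear.

Lemma rb_flip_basis d : rb_flip (basis x d) = basis x (flip d).
Proof.
by apply/ffunP => c; rewrite !ffunE -(inj_eq (inv_inj (@flipK n))) flipK.
Qed.

Lemma rb_flipM u v : rb_flip (u * v) = rb_flip v * rb_flip u.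
Proof.
rewrite [u]rb_sum [v]rb_sum !linear_sum /= mulr_suml !linear_sum /=.
under eq_bigr do rewrite mulr_sumr linear_sum.
rewrite mulr_suml exchange_big; apply: eq_bigr => d _; rewrite mulr_sumr.
apply: eq_bigr => c _; rewrite -scalerAl -scalerAr !linearZ /= -scalerAl -scalerAr.
rewrite !scalerA mulrC !rb_flip_basis !mul_basis linearZ /= rb_flip_basis.
by have [-> ->] := dcomp_flip c d.
Qed.

Lemma rb_flip_ecup i j : rb_flip (ecup i j) = ecup i j.
Proof. by rewrite rb_flip_basis flip_cup. Qed.

Lemma rb_flip_dot i : rb_flip (dot i) = dot i.
Proof. by rewrite linearZ /= rb_flip_ecup. Qed.

Lemma rb_flip_rho s : rb_flip (rho s) = rho s^-1.
Proof. by rewrite rb_flip_basis flip_perm. Qed.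

Lemma ecup_tperml i j : rho (tperm i j) * ecup i j = ecup i j.
Proof.
by have := congr1 rb_flip (ecup_tpermr i j); rewrite rb_flipM rb_flip_rho tpermV rb_flip_ecup.
Qed.

Lemma ecup_ecupl i j k : i != j -> j != k -> i != k ->
  ecup i j * ecup j k = rho (tperm i k) * ecup j k.
Proof.
move=> ij jk ik; have := congr1 rb_flip (ecup_ecup ij jk ik).
by rewrite !rb_flipM rb_flip_rho tpermV !rb_flip_ecup.
Qed.

Lemma flip_fixed (d : diagram n) i b c :
  val d (b, i) = (c, i) -> val (flip d) (~~ b, i) = (~~ c, i).
Proof. by move=> h; rewrite flipE /mirror /= negbK h. Qed.

Lemma basis_dot (d : diagram n) i : x != 0 -> val d (true, i) = (true, i) ->
  basis x d * dot i = basis x d.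
Proof.
move=> x0 /flip_fixed /(dot_basis x0) /(congr1 rb_flip).
by rewrite rb_flipM rb_flip_basis flipK rb_flip_dot.
Qed.

Lemma basis_ecup (d : diagram n) i j : val d (true, i) = (true, j) ->
  basis x d * ecup i j = x *: basis x d.
Proof.
move=> h; have : val (flip d) (false, i) = (false, j) by rewrite flipE /mirror /= h.
move/ecup_basis/(congr1 rb_flip).
by rewrite rb_flipM linearZ /= rb_flip_basis flipK rb_flip_ecup.
Qed.

Lemma dcomp_fixed (a b : diagram n) i :
  val a (false, i) = (false, i) -> val (dcomp a b) (false, i) = (false, i).
Proof.
move=> ai; apply: (@embO_inj n); have /connectP[[|w p] /= hp ->] := stackG_connect a b (false, i).
  by [].
case/andP: hp; rewrite stack_edgeE -[embO _]/(embA (false, i)) upperA ai => /andP[h].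
by rewrite /lower /= !(eq_sym w) (negbTE h).
Qed.

(** For a diagram [c], the product [dot i * basis x c] is a multiple of a single diagram whose top
    vertex [i] is isolated; elements fixed by [dot i] are supported on such diagrams. *)
Lemma dot_support u (d : diagram n) i :
  dot i * u = u -> u d != 0 -> val d (false, i) = (false, i).
Proof.
move=> <-; rewrite -scalerAl [u]rb_sum mulr_sumr ffunE sum_ffunE.
case: (eqVneq (val d (false, i)) (false, i)) => // di /eqP[].
rewrite big1 ?scaler0 // => c _; rewrite -scalerAr mul_basis !ffunE.
have [dE|_] := eqVneq d (dcomp (cup i i) c); last by rewrite !scaler0.
by case/eqP: di; rewrite dE dcomp_fixed // cupE eqxx.
Qed.

Lemma support_dot u (d : diagram n) i :
  u * dot i = u -> u d != 0 -> val d (true, i) = (true, i).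
Proof.
move=> /(congr1 rb_flip); rewrite rb_flipM rb_flip_dot => h ud.
have := dot_support h (d := flip d); rewrite ffunE flipK => /(_ ud).
by move/flip_fixed; rewrite flipK.
Qed.

Fact corner_subproof k : is_diagram [ffun v : vtx n => if (k <= v.2)%N then v else mirror v].
Proof.
apply/forallP => v; apply/eqP; rewrite !ffunE.
by case h: (k <= v.2)%N; rewrite /= ?h ?mirrorK.
Qed.
Definition corner_diagram k : diagram n := Sub _ (corner_subproof k).

(** The idempotent [f_k] of the overview; by [corner_n] and [cornerS] it is also the product of the
    [dot i] with [k <= i]. *)
Definition corner k : A := x ^- (n - k)%N *: basis x (corner_diagram k).

Lemma corner_diagramE k v :
  val (corner_diagram k) v = if (k <= v.2)%N then v else mirror v.
Proof. by rewrite ffunE. Qed.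

Lemma compat_corner k f g : compat (val (corner_diagram k)) f g =
  [forall i : 'I_n, (i < k)%N ==> (f i == g i)].
Proof.
apply/compatP/forallP => [h i|h [t i]].
  apply/implyP => ik; have := h (false, i); rewrite corner_diagramE /= leqNgt ik /=.
  by move=> /eqP; rewrite eq_sym.
rewrite corner_diagramE /=; case: leqP => // /(implyP (h i))/eqP.
by rewrite /side; case: t => /= ->.
Qed.

(** The diagrams [d] described here are those that survive between two copies of the level-[k]
    projector, see [level_corner]. *)
Lemma rho_corner (d : diagram n) k s : perm_on [set i : 'I_n | (i < k)%N] s ->
    (forall i : 'I_n, (i < k)%N -> val d (false, i) = (true, s i)) ->
    (forall (i : 'I_n) t, (k <= i)%N -> val d (t, i) = (t, i)) ->
  rho s * basis x (corner_diagram k) = basis x d.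
Proof.
move=> sk d1 d2; apply: word_rel0 (prod2 _ _) (prod1 _) _ => phi f.
have sK i : (s i < k)%N = (i < k)%N by have := perm_closed i sk; rewrite !inE.
rewrite /= op_perm; apply: eq_bigr => g _; congr (nat_of_bool _ * _)%N.
rewrite compat_corner; apply/forallP/compatP => [h [t i]|h i].
  have [ik|ki] := ltnP i k; last by rewrite d2.
  case: t; last first.
    rewrite d1 //; have := h (s i); rewrite sK ik !ffunE permK => /eqP.
    by rewrite /side /= => ->.
  have /d1 di : (s^-1%g i < k)%N by rewrite -sK permKV.
  rewrite -[i in LHS](permKV s) -di diagramK /side /=.
  by have := h i; rewrite ik !ffunE => /eqP.
apply/implyP => ik; rewrite ffunE; have /d1 di : (s^-1%g i < k)%N by rewrite -sK permKV.
by have := h (false, s^-1%g i); rewrite di /side /= permKV => ->.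
Qed.

Lemma corner_n : corner n = 1.
Proof.
rewrite /corner subnn expr0 invr1 scale1r; congr basis; apply/val_inj/ffunP => -[t i].
rewrite corner_diagramE /= leqNgt ltn_ord /= !ffunE /=.
by case: t; rewrite ?invg1 perm1.
Qed.

Lemma cornerS (k : 'I_n) : x != 0 -> dot k * corner k.+1 = corner k.
Proof.
move=> x0; rewrite -scalerAl -scalerAr scalerA -invfM -?exprS -?exprSr subnSK //.
congr (_ *: _); apply: word_rel0 (prod2 _ _) (prod1 _) _ => phi f.
rewrite /= op_dot; pose P f g := compat (val (corner_diagram k)) f g.
have hP t g : compat (val (corner_diagram k.+1)) (upd f k t) g = (g k == t) && P f g.
  rewrite /P !compat_corner; apply/forallP/andP => [h|[/eqP gk /forallP h] i].
    split; first by have := h k; rewrite ltnSn ffunE eqxx eq_sym.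
    apply/forallP => i; apply/implyP => ik; have := h i.
    by rewrite ltnW // ffunE -val_eqE /= ltn_eqF.
  apply/implyP; rewrite ltnS leq_eqVlt ffunE -val_eqE /=.
  case: eqP => [/val_inj ->|_] /=; first by rewrite gk.
  by move/(implyP (h i)).
rewrite /op -big_split; apply: eq_bigr => g _ /=; rewrite !hP -/(P f g) -mulnDl.
by case: (g k); case: (P f g).
Qed.

Lemma rb_flip_corner k : rb_flip (corner k) = corner k.
Proof.
rewrite linearZ /= rb_flip_basis; congr (_ *: basis x _).
apply/val_inj/ffunP => v; rewrite flipE !corner_diagramE /=.
by case: ifP; rewrite mirrorK.
Qed.

Lemma cornerSr (k : 'I_n) : x != 0 -> corner k.+1 * dot k = corner k.
Proof.
move=> x0; have /(congr1 rb_flip) := cornerS k x0.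
by rewrite rb_flipM rb_flip_dot !rb_flip_corner.
Qed.

Lemma dot_corner k (i : 'I_n) : x != 0 -> (k <= i)%N -> dot i * corner k = corner k.
Proof.
by move=> x0 ki; rewrite -scalerAr dot_basis // corner_diagramE ki.
Qed.

Lemma corner_dot k (i : 'I_n) : x != 0 -> (k <= i)%N -> corner k * dot i = corner k.
Proof.
by move=> x0 ki; rewrite -scalerAl basis_dot // corner_diagramE ki.
Qed.

End Relations.

(** * Eigenvalues of Jucys-Murphy elements *)

(** Makes the tactic [non_commutative_ring] usable in every [pzRingType]. *)
#[global] Instance pzring_ncops (A : pzRingType) :
  @Ncring.Ring_ops A 0 1 +%R *%R (fun x y => x - y) -%R eq := {}.
#[global] Instance pzring_ncring (A : pzRingType) : @Ncring.Ring A _ _ _ _ _ _ _ (pzring_ncops A).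
Proof.
constructor; try exact: RelationClasses.eq_equivalence;
  try solve [by move=> x y -> u v -> | by move=> x y -> | by []].
- exact: add0r.
- exact: addrC.
- exact: addrA.
- exact: mul1r.
- exact: mulr1.
- exact: mulrA.
- exact: mulrDl.
- by move=> x y z; exact: mulrDr.
- exact: subrr.
Qed.

Section Horner.
Variables (F : fieldType) (A : algType F).
Implicit Types (a b u v : A) (p q : {poly F}).

Lemma commC u (c : F) : GRing.comm u c%:A.
Proof. by rewrite /GRing.comm -scalerAl -scalerAr mul1r mulr1. Qed.

Lemma comm_horner u a p : GRing.comm u a -> GRing.comm u (horner_alg a p).
Proof.
move=> ua; elim/poly_ind: p => [|p c IHp]; first by rewrite rmorph0; apply: commr0.
rewrite rmorphD rmorphM /= horner_algX horner_algC.
by apply: commrD (commC _ _); apply: commrM.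
Qed.

Lemma horner_intertwine u a b p : a * u = u * b ->
  horner_alg a p * u = u * horner_alg b p.
Proof.
move=> h; elim/poly_ind: p => [|p c IHp]; first by rewrite !rmorph0 mul0r mulr0.
rewrite !rmorphD !rmorphM /= !horner_algX !horner_algC mulrDl mulrDr.
by rewrite -mulrA h mulrA IHp -!mulrA -(commC u c).
Qed.

Definition roots_poly (C : seq F) : {poly F} := \prod_(c <- C) ('X - c%:P).

Lemma horner_root a c : horner_alg a ('X - c%:P) = a - c%:A.
Proof. by rewrite rmorphB /= horner_algX horner_algC. Qed.

(* With [phi = s a - a s] one has [b phi = phi a] and [phi^2 = 1 - (a - b)^2], so
   an eigenvalue of [b] is an eigenvalue of [a] shifted by [0], [1] or [-1]. *)
Lemma jm_poly_step a b s (C : seq F) :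
    s * s = 1 -> b = s * a * s + s -> GRing.comm a b ->
    horner_alg a (roots_poly C) = 0 ->
  horner_alg b (roots_poly (flatten [seq [:: c - 1; c + 1] | c <- C] ++ C)) = 0.
Proof.
move=> ss bE ab pa.
have bs : b * s = s * a + 1 by rewrite bE mulrDl -mulrA ss mulr1.
have sb : s * b = a * s + 1 by rewrite bE mulrDr !mulrA ss mul1r.
pose phi := s * a - a * s.
have b_phi : b * phi = phi * a.
  rewrite /phi mulrBr mulrBl !mulrA bs -ab -(mulrA a b s) bs.
  by Ncring_tac.non_commutative_ring.
have phi2 : phi * phi = 1 - (a - b) * (a - b).
  have e1 : s * a = b * s - 1 by rewrite bs addrK.
  have e2 : a * s = s * b - 1 by rewrite sb addrK.
  have h1 : s * a * (s * a) = b * a - s * a.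
    by rewrite {1}e1 mulrBl mul1r mulrA -(mulrA b) ss mulr1.
  have h2 : s * a * (a * s) = b * b - b * s - s * b + 1.
    rewrite e1 e2; transitivity (b * (s * s) * b - b * s - s * b + 1).
      by Ncring_tac.non_commutative_ring.
    by rewrite ss mulr1.
  have h3 : a * (s * a) * s = a * b - a * s.
    by rewrite e1 mulrBr mulr1 mulrBl !mulrA -(mulrA _ s) ss mulr1.
  have h4 : a * s * (s * a) = a * a by rewrite mulrA -(mulrA a) ss mulr1.
  transitivity (s * a * (s * a) - s * a * (a * s) - a * s * (s * a) + a * (s * a) * s).
    by rewrite /phi; Ncring_tac.non_commutative_ring.
  by rewrite h1 h2 h3 h4 e1 e2; Ncring_tac.non_commutative_ring.
(* The extra factor [roots_poly C] in the conclusion is there for [y]: as [b phi = phi a], one has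
   [y phi = 0], and [phi^2 = u] then gives [u y = 0]. So [(a - b)^2] acts as 1 on the multiples of
   [y]. *)
set y := horner_alg b (roots_poly C).
have y_phi : y * phi = 0 by rewrite (horner_intertwine _ b_phi) pa mulr0.
pose u := 1 - (a - b) * (a - b).
have uy : u * y = 0.
  have cy : GRing.comm y u.
    apply/commr_sym/comm_horner; rewrite /u; apply/commr_sym.
    have := commrB (commr_sym ab) (commr_refl b) => h.
    exact: commrB (commr1 _) (commrM h h).
  by rewrite -cy /u -phi2 mulrA y_phi mul0r.
rewrite /roots_poly big_cat /= rmorphM /= -/(roots_poly C) -/y.
suff [w [_ _ ->]] : exists w, [/\ GRing.comm a w, GRing.comm b w &
    horner_alg b (\prod_(c <- flatten [seq [:: c - 1; c + 1] | c <- C]) ('X - c%:P)) * y =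
    horner_alg a (roots_poly C) * w * y] by rewrite pa !mul0r.
move: y uy {y_phi pa} => y uy; elim: C => [|c D [w [aw bw IHD]]].
  exists 1; split; [exact: commr1|exact: commr1|].
  by rewrite /roots_poly !big_nil !rmorph1 mulr1.
(* Up to [u], the factors for [c - 1] and [c + 1] multiply to [be^2 - 1 = al (2 be - al)], which
   supplies the factor [a - c] of [roots_poly C] evaluated at [a]. *)
pose al := a - c%:A; pose be := b - c%:A; pose ka := be + be - al.
have alb : GRing.comm al be.
  apply: commrB (commC _ _); apply/commr_sym.
  by apply: commrB (commC _ _); apply/commr_sym.
have a_al : GRing.comm a al by apply: commrB (commr_refl _) (commC _ _).
have b_be : GRing.comm b be by apply: commrB (commr_refl _) (commC _ _).
have a_be : GRing.comm a be by apply: commrB ab (commC _ _).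
have b_al : GRing.comm b al by apply: commrB (commr_sym ab) (commC _ _).
have a_ka : GRing.comm a ka by apply: commrB a_al; apply: commrD.
have b_ka : GRing.comm b ka by apply: commrB b_al; apply: commrD.
exists (ka * w); split; [exact: commrM|exact: commrM|].
rewrite /= /roots_poly !big_cons !rmorphM /= -/(roots_poly D) !horner_root -/al.
have -> : b - (c - 1)%:A = be + 1 by rewrite scalerBl scale1r opprB addrA addrAC.
have -> : b - (c + 1)%:A = be - 1 by rewrite scalerDl scale1r opprD addrA.
set P := horner_alg a (roots_poly D).
have u_comm v : GRing.comm a v -> GRing.comm b v -> GRing.comm u v.
  move=> av bv; apply/commr_sym/commrB; first exact: commr1.
  by apply: commrM; apply: commrB; apply/commr_sym.
have kaP : GRing.comm ka P by apply: comm_horner; apply/commr_sym.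
have uP : GRing.comm u P by apply: comm_horner; apply: u_comm (commr_refl _) (commr_sym ab).
have bb : (be + 1) * (be - 1) = al * ka - u.
  transitivity (al * ka - u + (be * al - al * be)); last by rewrite alb subrr addr0.
  have -> : u = 1 - (al - be) * (al - be).
    by rewrite /u /al /be opprB subrKA.
  by rewrite /ka; Ncring_tac.non_commutative_ring.
rewrite -2!mulrA IHD mulrA bb mulrBl.
have -> : u * (P * w * y) = 0.
  by rewrite !mulrA uP -(mulrA P) (u_comm w aw bw) -!mulrA uy !mulr0.
by rewrite subr0 -!mulrA; congr (al * _); rewrite !mulrA kaP.
Qed.

End Horner.

Definition low n (k : nat) : {set 'I_n} := [set i : 'I_n | (i < k)%N].

Lemma low_perm n k (s : 'S_n) i : perm_on (low n k) s -> (s i \in low n k) = (i \in low n k).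
Proof. exact: perm_closed. Qed.

Lemma low_fix n k (s : 'S_n) (i : 'I_n) : perm_on (low n k) s -> (k <= i)%N -> s i = i.
Proof. by move=> hs ki; apply: out_perm hs _; rewrite inE -leqNgt. Qed.

Lemma low_permW n k l (s : 'S_n) : (k <= l)%N -> perm_on (low n k) s -> perm_on (low n l) s.
Proof.
move=> kl hs; apply: subset_trans hs _; apply/subsetP => i.
by rewrite !inE => /leq_trans; apply.
Qed.

Lemma low_tperm n k (i j : 'I_n) : (i < k)%N -> (j < k)%N -> perm_on (low n k) (tperm i j).
Proof.
by move=> ik jk; apply: subset_trans (tperm_on _ _) _; apply/subsetP => l;
  rewrite !inE => /orP[]/eqP->.
Qed.

Section Stars.
Variables (F : fieldType) (A : algType F) (n : nat).

(** For [g = swap] and [j] of value [k] this is a Jucys-Murphy element; for [j < k] it is the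
    conjugate, by a transposition, of the one of index [k - 1]. *)
Definition star (g : 'I_n -> 'I_n -> A) k j : A := \sum_(i in low n k | i != j) g i j.

Lemma star1 (g : 'I_n -> 'I_n -> A) (m : 'I_n) : star g m m = \sum_(i < n | (i < m)%N) g i m.
Proof.
apply: eq_bigl => i; rewrite inE; have [im|//] := ltnP i m.
by rewrite -val_eqE /= ltn_eqF.
Qed.

Lemma comm_star (g : 'I_n -> 'I_n -> A) k (j : 'I_n) (u : A) : (forall i : 'I_n, (i < k)%N -> i != j -> GRing.comm u (g i j)) ->
  GRing.comm u (star g k j).
Proof. by move=> h; apply: commr_sum => i; rewrite inE => /andP[]; apply: h. Qed.

Variable rho : 'S_n -> A.
Hypotheses (rho1 : rho 1%g = 1) (rhoM : forall s t, rho s * rho t = rho (s * t)%g).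

Lemma star_rho (g : 'I_n -> 'I_n -> A) k (j : 'I_n) s : (forall i l, g i l * rho s = rho s * g (s i) (s l)) ->
  perm_on (low n k) s -> star g k j * rho s = rho s * star g k (s j).
Proof.
move=> hg hs; rewrite mulr_suml mulr_sumr [RHS](reindex_inj (@perm_inj _ s)) /=.
by apply: eq_big => i; [rewrite low_perm // (inj_eq perm_inj)|rewrite hg].
Qed.

Definition swap i j := rho (tperm i j).

Lemma swap_rho s i j : swap i j * rho s = rho s * swap (s i) (s j).
Proof. by rewrite !rhoM conjgC tpermJ. Qed.

Lemma swap_sq i j : swap i j * swap i j = 1.
Proof. by rewrite rhoM tperm2. Qed.

Lemma swapC i j : swap i j = swap j i.
Proof. by rewrite /swap tpermC. Qed.

Lemma rhoVK s : rho s * rho s^-1 = 1.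
Proof. by rewrite rhoM mulgV. Qed.
Lemma rhoKV s : rho s^-1 * rho s = 1.
Proof. by rewrite rhoM mulVg. Qed.

Definition jucys (m : 'I_n) := star swap m m.

Lemma jucys_rho (m : 'I_n) s : perm_on (low n m) s -> GRing.comm (jucys m) (rho s).
Proof.
move=> hs; rewrite /GRing.comm /jucys star_rho //; last by move=> i l; apply: swap_rho.
by rewrite (low_fix hs).
Qed.

Lemma jucys_succ (m m' : 'I_n) : m' = m.+1 :> nat ->
  jucys m' = swap m m' * jucys m * swap m m' + swap m m'.
Proof.
move=> mm; rewrite /jucys !star1 (bigD1 m) /= ?mm // addrC; congr (_ + _).
rewrite mulr_sumr mulr_suml; apply: eq_big => [i|i /andP[]].
  by rewrite ltnS leq_eqVlt -val_eqE /=; case: ltngtP.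
rewrite ltnS leq_eqVlt => /orP[/eqP/val_inj->|im _]; first by rewrite eqxx.
rewrite -mulrA swap_rho tpermL tpermD ?mulrA ?swap_sq ?mul1r //.
  by rewrite -val_eqE /= gtn_eqF.
by rewrite -val_eqE /= mm gtn_eqF // ltnS ltnW.
Qed.

Lemma jucys_comm (m m' : 'I_n) : (m < m')%N -> GRing.comm (jucys m') (jucys m).
Proof.
move=> mm; apply: comm_star => i im _; apply: jucys_rho.
by apply: low_tperm => //; apply: ltn_trans mm.
Qed.

Definition int_roots (C : seq int) : {poly F} := roots_poly [seq z%:~R | z <- C].

(** Induction along [jucys_succ], starting from the zero element: [jm_poly_step] shifts roots by at
    most one, so they stay integers. Roots may repeat here; [jucys_squarefree] removes the
    repetitions later. *)
Lemma jucys_poly (m : 'I_n) : exists C, horner_alg (jucys m) (int_roots C) = 0.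
Proof.
case: m; elim=> [|k IHk] hk.
  exists [:: 0]; rewrite /int_roots /roots_poly big_seq1 horner_root scale0r subr0.
  by rewrite /jucys star1 big1.
have [C hC] := IHk (ltnW hk); set m := Ordinal _ in hC; set m' := Ordinal hk.
exists (flatten [seq [:: c - 1; c + 1] | c <- C] ++ C).
have := jm_poly_step (swap_sq m m') (@jucys_succ m m' erefl) (commr_sym (@jucys_comm m m' (ltnSn k))) hC.
rewrite /int_roots map_cat map_flatten -!map_comp; congr (_ _ (roots_poly (flatten _ ++ _)) = 0).
by apply: eq_map => c /=; rewrite rmorphB rmorphD.
Qed.

(** All these elements are conjugate to the Jucys-Murphy element of the last index below [k], so one
    polynomial serves for all of them. *)
Lemma swap_star_poly (k : nat) : (k <= n)%N ->
  exists C, forall j : 'I_n, (j < k)%N -> horner_alg (star swap k j) (int_roots C) = 0.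
Proof.
case: k => [|k] kn; first by exists [::].
have [C hC] := jucys_poly (Ordinal kn); set m := Ordinal _ in hC; exists C => j jk.
have sm : star swap k.+1 m = jucys m.
  rewrite /jucys star1; apply: eq_bigl => i; rewrite inE -val_eqE /=.
  by rewrite ltnS; case: ltngtP.
have mk : (m < k.+1)%N by [].
have := star_rho j (swap_rho (tperm j m)) (low_tperm jk mk); rewrite tpermL sm.
move/(horner_intertwine (int_roots C)); rewrite hC mulr0 => /(congr1 ( *%R ^~ (rho (tperm j m)))).
by rewrite mul0r -mulrA swap_sq mulr1.
Qed.

End Stars.

(** * The traceless projector of a Brauer algebra *)

Lemma coprimep_roots (F : fieldType) (C D : seq F) :
  (forall c, c \in C -> c \notin D) -> coprimep (roots_poly D) (roots_poly C).
Proof.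
move=> h; rewrite /roots_poly; elim: C h => [|c C IHC] h.
  by rewrite big_nil coprimep1.
rewrite big_cons coprimepMr coprimep_XsubC root_prod_XsubC h ?mem_head //=.
by apply: IHC => c' hc'; apply: h; rewrite inE hc' orbT.
Qed.

Lemma horner_roots_opp (F : fieldType) (A : algType F) (a : A) c0 (C : seq F) :
  horner_alg a (roots_poly C) = 0 ->
  horner_alg (c0%:A - a) (roots_poly [seq c0 - c | c <- C]) = 0.
Proof.
move=> ha; suff -> : horner_alg (c0%:A - a) (roots_poly [seq c0 - c | c <- C]) =
    (-1) ^+ size C * horner_alg a (roots_poly C) by rewrite ha mulr0.
rewrite /roots_poly; elim: C {ha} => [|c C IHC]; first by rewrite !big_nil !rmorph1 mulr1.
rewrite /= !big_cons !rmorphM /= IHC !horner_root scalerBl.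
have -> : c0%:A - a - (c0%:A - c%:A) = - (a - c%:A).
  by Ncring_tac.non_commutative_ring.
rewrite exprS !mulNr mul1r !mulrA; congr (- (_ * _)).
exact: commrX (commrN1 _).
Qed.

Section Brauer.
Variables (F : fieldType) (A : algType F) (n : nat).
Variable rho : 'S_n -> A.
Hypotheses (rho1 : rho 1%g = 1) (rhoM : forall s t, rho s * rho t = rho (s * t)%g).
Variables (K : nat) (e : 'I_n -> 'I_n -> A) (delta : F).
Local Notation swap := (swap rho).
Local Notation jucys := (jucys rho).

Hypothesis Kn : (K <= n)%N.
Hypothesis deltaZ : forall z : int, delta != z%:~R.
Hypothesis e_rho : forall s i j, perm_on (low n K) s ->
  e i j * rho s = rho s * e (s i) (s j).
Hypothesis eC : forall i j, e i j = e j i.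
Hypothesis e_swap : forall i j : 'I_n, (i < K)%N -> (j < K)%N -> i != j ->
  e i j * swap i j = e i j /\ swap i j * e i j = e i j.
Hypothesis e_sq : forall i j : 'I_n, (i < K)%N -> (j < K)%N -> i != j ->
  e i j * e i j = delta *: e i j.
Hypothesis e_e : forall i j k : 'I_n, (i < K)%N -> (j < K)%N -> (k < K)%N ->
  i != j -> j != k -> i != k ->
  e j k * e i j = e j k * swap i k /\ e i j * e j k = swap i k * e j k.
Hypothesis e_comm : forall i j k l : 'I_n, (i < K)%N -> (j < K)%N -> (k < K)%N ->
  (l < K)%N -> i != k -> i != l -> j != k -> j != l ->
  e i j * e k l = e k l * e i j.

(** Subtracting the contractions is what makes the case [j = m] commute with the contractions below
    [m], see [brauer_jucys_e]. *)
Definition brauer_star m j := star swap m j - star e m j.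
Definition brauer_jucys (m : 'I_n) := brauer_star m m.

Lemma comm_brauer_star m (j : 'I_n) u :
    (forall i : 'I_n, (i < m)%N -> i != j -> GRing.comm u (swap i j) /\ GRing.comm u (e i j)) ->
  GRing.comm u (brauer_star m j).
Proof. by move=> h; apply: commrB; apply: comm_star => i im ij; have [] := h i im ij. Qed.

Lemma brauer_jucys_rho (m : 'I_n) s : (m < K)%N -> perm_on (low n m) s ->
  GRing.comm (brauer_jucys m) (rho s).
Proof.
move=> mK hs; apply/commr_sym/commrB; apply/commr_sym; first exact: jucys_rho.
rewrite /GRing.comm star_rho // ?(low_fix hs) //.
by move=> i l; apply: e_rho; apply: low_permW hs; apply: ltnW.
Qed.

Lemma brauer_starE m (j : 'I_n) : brauer_star m j = star (fun i j => swap i j - e i j) m j.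
Proof. by rewrite /brauer_star /star sumrB. Qed.

Lemma ltI_neq (i j : 'I_n) : (i < j)%N -> i != j.
Proof. by move=> h; rewrite -val_eqE /= ltn_eqF. Qed.

(** The four terms involving [i] and [j] cancel against [e i j] on either side, by
    [e i j * e j m = e i j * swap i m] and its analogues; the other terms commute with [e i j] one
    by one. *)
Lemma brauer_jucys_e (m i j : 'I_n) : (m < K)%N -> (i < m)%N -> (j < m)%N -> i != j ->
  GRing.comm (brauer_jucys m) (e i j).
Proof.
move=> mK im jm ij; have [iK jK] := (ltn_trans im mK, ltn_trans jm mK).
have [im' jm'] := (ltI_neq im, ltI_neq jm); have mj : m != j by rewrite eq_sym.
have mi : m != i by rewrite eq_sym.
have ji : j != i by rewrite eq_sym.
have [a1 a2] := e_e mK jK iK mj ji mi; have [b1 b2] := e_e mK iK jK mi ij mj.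
rewrite (eC m j) (eC j i) !(swapC _ m) in a1 a2; rewrite (eC m i) !(swapC _ m) in b1 b2.
apply/commr_sym; rewrite /brauer_jucys brauer_starE star1 (bigD1 i) //= (bigD1 j) /= ?jm //.
rewrite addrA; apply: commrD.
  by rewrite /GRing.comm !(mulrDr, mulrDl, mulrN, mulNr) a1 a2 b1 b2;
    Ncring_tac.non_commutative_ring.
apply: commr_sum => l /andP[/andP[lm li] lj].
have lK := ltn_trans lm mK.
apply: commrB; last by apply: e_comm; rewrite // eq_sym.
rewrite /GRing.comm /swap e_rho; last exact: low_tperm.
by rewrite !tpermD.
Qed.

(** The term of index [j] gives [1 - delta], as [e j m] absorbs [swap j m] and squares to
    [delta *: e j m]. For the other [i], next to [e j m], the relations replace [swap i m] by
    [e i j] and [e i m] by [swap i j], which reverses the sign. *)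
Lemma brauer_jucys_contract (m j : 'I_n) : (m < K)%N -> (j < m)%N ->
  e j m * brauer_jucys m = e j m * ((1 - delta)%:A - brauer_star m j) /\
  brauer_jucys m * e j m = ((1 - delta)%:A - brauer_star m j) * e j m.
Proof.
move=> mK jm; have jK := ltn_trans jm mK; have jm' := ltI_neq jm.
have [s1 s2] := e_swap jK mK jm'.
rewrite /brauer_jucys !brauer_starE star1 (bigD1 j) //= /star.
have -> : \sum_(i in low n m | i != j) (swap i j - e i j) =
    \sum_(i < n | (i < m)%N && (i != j)) (swap i j - e i j).
  by apply: eq_bigl => i; rewrite inE.
have dE : e j m * (1 - delta)%:A = e j m - delta *: e j m.
  by rewrite -scalerAr mulr1 scalerBl scale1r.
have dE' : (1 - delta)%:A * e j m = e j m - delta *: e j m.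
  by rewrite -commC dE.
split.
  rewrite mulrDr !mulrBr s1 e_sq // dE; congr (_ + _).
  rewrite !mulr_sumr -sumrN; apply: eq_bigr => i /andP[im ij].
  have iK := ltn_trans im mK; have im' := ltI_neq im; have mj : m != j by rewrite eq_sym.
  have [a _] := e_e iK jK mK ij jm' im'.
  have [b _] := e_e iK mK jK im' mj ij.
  by rewrite !mulrBr a (eC j m) -b opprB.
rewrite mulrDl !mulrBl s2 e_sq // dE'; congr (_ + _).
rewrite !mulr_suml -sumrN; apply: eq_bigr => i /andP[im ij].
have iK := ltn_trans im mK; have im' := ltI_neq im; have mj : m != j by rewrite eq_sym.
have [_ a] := e_e iK jK mK ij jm' im'.
have [_ b] := e_e iK mK jK im' mj ij.
by rewrite !mulrBl a (eC j m) -b opprB.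
Qed.

Definition left_killed (m : nat) v := forall i j : 'I_n,
  (i < m)%N -> (j < m)%N -> i != j -> e i j * v = 0.
Definition right_killed (m : nat) v := forall i j : 'I_n,
  (i < m)%N -> (j < m)%N -> i != j -> v * e i j = 0.

Section Closure.
Variable m : nat.
Hypothesis mK : (m <= K)%N.

Lemma left_killed_rho v s : perm_on (low n m) s -> left_killed m v -> left_killed m (rho s * v).
Proof.
move=> hs hv i j im jm ij; rewrite mulrA e_rho ?(low_permW mK) //.
by rewrite -mulrA hv ?mulr0 ?(inj_eq perm_inj) //;
  [have := low_perm i hs | have := low_perm j hs]; rewrite !inE => ->.
Qed.

Lemma right_killed_rho v s : perm_on (low n m) s -> right_killed m v -> right_killed m (v * rho s).
Proof.
move=> hs hv i j im jm ij; have hs' : perm_on (low n m) s^-1%g by apply: perm_onV.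
have := e_rho i j (low_permW mK hs').
move/(congr1 (fun y => rho s * y * rho s)); rewrite !mulrA rhoVK // mul1r -(mulrA _ (rho s^-1%g)).
rewrite rhoKV // mulr1 => h; rewrite -mulrA h mulrA hv ?mul0r ?(inj_eq perm_inj) //;
  [have := low_perm i hs' | have := low_perm j hs']; by rewrite !inE => ->.
Qed.

Lemma left_killedD v w : left_killed m v -> left_killed m w -> left_killed m (v + w).
Proof. by move=> hv hw i j im jm ij; rewrite mulrDr hv ?hw ?addr0. Qed.
Lemma right_killedD v w : right_killed m v -> right_killed m w -> right_killed m (v + w).
Proof. by move=> hv hw i j im jm ij; rewrite mulrDl hv ?hw ?addr0. Qed.
Lemma left_killedM v w : left_killed m v -> left_killed m (v * w).
Proof. by move=> hv i j im jm ij; rewrite mulrA hv ?mul0r. Qed.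
Lemma right_killedM v w : right_killed m v -> right_killed m (w * v).
Proof. by move=> hv i j im jm ij; rewrite -mulrA hv ?mulr0. Qed.

Lemma left_killed_star v (j : 'I_n) : (j < m)%N -> left_killed m v ->
  left_killed m (star swap m j * v) /\ brauer_star m j * v = star swap m j * v.
Proof.
move=> jm hv; split.
  rewrite mulr_suml; apply: (big_ind (left_killed m)) => [|v1 v2|i /andP[im ij]].
  - by move=> i k *; rewrite mulr0.
  - exact: left_killedD.
  - by apply: left_killed_rho hv; apply: low_tperm => //; rewrite inE in im.
rewrite mulrBl [X in _ - X]mulr_suml [X in _ - X]big1 ?subr0 // => i /andP[].
by rewrite inE => im ij; apply: hv.
Qed.

Lemma right_killed_star v (j : 'I_n) : (j < m)%N -> right_killed m v ->
  right_killed m (v * star swap m j) /\ v * brauer_star m j = v * star swap m j.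
Proof.
move=> jm hv; split.
  rewrite mulr_sumr; apply: (big_ind (right_killed m)) => [|v1 v2|i /andP[im ij]].
  - by move=> i k *; rewrite mul0r.
  - exact: right_killedD.
  - by apply: right_killed_rho hv; apply: low_tperm => //; rewrite inE in im.
rewrite mulrBr [X in _ - X]mulr_sumr [X in _ - X]big1 ?subr0 // => i /andP[].
by rewrite inE => im ij; apply: hv.
Qed.

End Closure.

(** On a [v] killed by the contractions below [m], [brauer_star m j] reduces to its transpositions,
    whose eigenvalues are integers. So next to [e j m] the polynomial is evaluated at [1 - delta]
    minus integers. *)
Lemma brauer_contract_poly (m j : 'I_n) v p : (m < K)%N -> (j < m)%N -> left_killed m v ->
  e j m * (horner_alg (brauer_jucys m) p * v) =
  e j m * (horner_alg ((1 - delta)%:A - star swap m j) p * v).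
Proof.
move=> mK jm; have [J _] := brauer_jucys_contract mK jm.
have mKw := ltnW mK.
have JJ : GRing.comm (brauer_jucys m) ((1 - delta)%:A - brauer_star m j).
  apply: commrB (commC _ _) _; apply: comm_brauer_star => i im ij.
  split; last exact: brauer_jucys_e.
  by apply: brauer_jucys_rho => //; apply: low_tperm.
elim/poly_ind: p v => [|p c IHp] v hv; first by rewrite !rmorph0 !mul0r.
rewrite !rmorphD !rmorphM /= !horner_algX !horner_algC.
rewrite ![(_ + c%:A) * v]mulrDl ![_ * (_ + c%:A * v)]mulrDr; congr (_ + _).
have [hv1 hv2] := left_killed_star mKw jm hv.
set C := (1 - delta)%:A in J JJ *; set J0 := brauer_jucys m in J JJ *.
have Jp : GRing.comm J0 (horner_alg J0 p) by apply: comm_horner.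
have Bp := comm_horner p (commr_sym JJ).
(* One factor [J0] is carried to [e j m], becomes [C - brauer_star m j] there, and is brought back
   to [v], where the contractions vanish. Hence the induction lets [v] vary. *)
transitivity (e j m * (horner_alg J0 p * ((C - brauer_star m j) * v))).
  rewrite -Jp -(mulrA J0) (mulrA (e j m)) J -(mulrA (e j m)).
  by rewrite (mulrA _ (horner_alg J0 p)) Bp -mulrA.
rewrite mulrBl hv2 -mulrBl IHp ?mulrA // mulrBl -mulrN.
apply: left_killedD; first by rewrite /C -commC; apply: left_killedM.
by rewrite mulrN -mulrN1; apply: left_killedM.
Qed.

Lemma brauer_poly_contract (m j : 'I_n) v p : (m < K)%N -> (j < m)%N -> right_killed m v ->
  v * horner_alg (brauer_jucys m) p * e j m =
  v * horner_alg ((1 - delta)%:A - star swap m j) p * e j m.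
Proof.
move=> mK jm; have [_ J] := brauer_jucys_contract mK jm.
have mKw := ltnW mK.
have JJ : GRing.comm (brauer_jucys m) ((1 - delta)%:A - brauer_star m j).
  apply: commrB (commC _ _) _; apply: comm_brauer_star => i im ij.
  split; last exact: brauer_jucys_e.
  by apply: brauer_jucys_rho => //; apply: low_tperm.
elim/poly_ind: p v => [|p c IHp] v hv; first by rewrite !rmorph0 !mulr0.
rewrite !rmorphD !rmorphM /= !horner_algX !horner_algC.
rewrite ![v * (_ + c%:A)]mulrDr ![(_ + v * c%:A) * _]mulrDl; congr (_ + _).
have [hv1 hv2] := right_killed_star mKw jm hv.
set C := (1 - delta)%:A in J JJ *; set J0 := brauer_jucys m in J JJ *.
have Bp := comm_horner p (commr_sym JJ).
transitivity (v * (C - brauer_star m j) * horner_alg J0 p * e j m).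
  by rewrite -mulrA -(mulrA _ J0) J (mulrA (horner_alg J0 p)) -Bp !mulrA.
have Cp : GRing.comm (C - star swap m j) (horner_alg (C - star swap m j) p).
  exact: comm_horner.
rewrite mulrBr hv2 -mulrBr IHp -?Cp ?mulrA // mulrBr -mulrN.
apply: right_killedD; first by rewrite /C commC; apply: right_killedM.
by rewrite mulrN -mulN1r; apply: right_killedM.
Qed.

(* Adjoining the index [m] multiplies the projector by a polynomial [g] in the
   Jucys-Murphy element [J] of index [m].  Modulo the contractions, [J] is the
   Jucys-Murphy element of the symmetric group, with integer eigenvalues, whereas
   on the contractions [e j m] its eigenvalues are [1 - delta - c] with [c] an
   integer; as [delta] is not an integer, some [g] is [1] on the former and [0] on
   the latter. *)
Lemma brauer_projector (f : A) (I : A -> Prop) (m : nat) :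
    I 0 -> (forall a b, I a -> I b -> I (a + b)) ->
    (forall a b, I b -> I (a * b)) -> (forall a b, I a -> I (a * b)) ->
    (forall s, perm_on (low n K) s -> GRing.comm f (rho s)) ->
    (forall i j : 'I_n, (i < K)%N -> (j < K)%N -> i != j ->
       GRing.comm f (e i j) /\ I (f * e i j)) ->
  (m <= K)%N ->
  exists z, [/\ left_killed m z, right_killed m z,
    (forall u, (forall s, perm_on (low n m) s -> GRing.comm u (rho s)) ->
       (forall i j : 'I_n, (i < m)%N -> (j < m)%N -> i != j -> GRing.comm u (e i j)) ->
       GRing.comm u z),
    I (f * (1 - z)) &
    (forall v, right_killed m v -> v * z = v) /\ (forall v, left_killed m v -> z * v = v)].
Proof.
move=> I0 ID IM IMr f_rho f_e; elim: m => [|m IHm] mK.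
  exists 1; split; try by move=> i j; rewrite ltn0.
  - by move=> *; apply: commr1.
  - by rewrite subrr mulr0.
  - by split=> v _; rewrite ?mulr1 ?mul1r.
have [z [zl zr z_comm zI [zr_id zl_id]]] := IHm (ltnW mK).
have mn : (m < n)%N := leq_trans mK Kn.
pose M := Ordinal mn; set J := brauer_jucys M.
have [C hC] := jucys_poly rho1 rhoM M.
have [D hD] := swap_star_poly rho1 rhoM (ltnW mn).
set P := int_roots F C in hC; pose Q := roots_poly [seq (1 - delta) - c | c <- [seq z%:~R | z <- D]].
(* A common root [w = 1 - delta - w'] with integers [w] and [w'] would make [delta = 1 - w - w'] an
   integer. *)
have /Bezout_eq1_coprimepP[[S R] /= SR] : coprimep P Q.
  apply: coprimep_roots => c /mapP[_ /mapP[w _ ->] ->]; apply/mapP => -[w' _ eq].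
  have := deltaZ (1 - w - w'); rewrite !rmorphB /= -eq => /eqP[].
  by Ncring_tac.non_commutative_ring.
pose g := horner_alg J (R * Q).
have gE : g = 1 - horner_alg J (S * P).
  by rewrite /g -(rmorph1 (horner_alg J)) -SR -rmorphB /= addrAC subrr add0r.
have QJ (j : 'I_n) : (j < m)%N -> horner_alg ((1 - delta)%:A - star swap m j) (R * Q) = 0.
  by move=> jm; rewrite rmorphM /= (horner_roots_opp _ (hD _ jm)) mulr0.
have zJ : GRing.comm z J.
  apply/commr_sym/z_comm => [s hs|i j im jm ij]; first exact: (@brauer_jucys_rho M).
  exact: (@brauer_jucys_e M).
have zg : GRing.comm z g by apply: comm_horner.
have aPJ v : right_killed m.+1 v -> v * horner_alg J P = 0.
  suff gen p : right_killed m.+1 v -> v * horner_alg J p = v * horner_alg (jucys M) p.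
    by move=> hv; rewrite gen // hC mulr0.
  elim/poly_ind: p v => [|p c IHp] v hv; first by rewrite !rmorph0.
  have vJ : v * J = v * jucys M.
    rewrite /J /brauer_jucys /brauer_star mulrBr [X in _ - X]mulr_sumr [X in _ - X]big1 ?subr0 //.
    by move=> i /andP[]; rewrite inE => im iM; apply: hv => //; rewrite ltnW.
  have vJ' : right_killed m.+1 (v * jucys M).
    rewrite mulr_sumr; apply: (big_ind (right_killed m.+1)) => [|v1 v2|i /andP[im ij]].
    - by move=> i k *; rewrite mul0r.
    - exact: right_killedD.
    - apply: right_killed_rho => //; apply: low_tperm => //.
      by rewrite inE in im; rewrite ltnW.
  rewrite !rmorphD !rmorphM /= !horner_algX !horner_algC.
  rewrite ![v * (_ + c%:A)]mulrDr; congr (_ + _).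
  have Jp := comm_horner p (commr_refl J).
  have jp := comm_horner p (commr_refl (jucys M)).
  by rewrite -Jp -jp !mulrA vJ IHp.
have PJa v : left_killed m.+1 v -> horner_alg J P * v = 0.
  suff gen p : left_killed m.+1 v -> horner_alg J p * v = horner_alg (jucys M) p * v.
    by move=> hv; rewrite gen // hC mul0r.
  elim/poly_ind: p v => [|p c IHp] v hv; first by rewrite !rmorph0.
  have vJ : J * v = jucys M * v.
    rewrite /J /brauer_jucys /brauer_star mulrBl [X in _ - X]mulr_suml [X in _ - X]big1 ?subr0 //.
    by move=> i /andP[]; rewrite inE => im iM; apply: hv => //; rewrite ltnW.
  have vJ' : left_killed m.+1 (jucys M * v).
    rewrite mulr_suml; apply: (big_ind (left_killed m.+1)) => [|v1 v2|i /andP[im ij]].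
    - by move=> i k *; rewrite mulr0.
    - exact: left_killedD.
    - apply: left_killed_rho => //; apply: low_tperm => //.
      by rewrite inE in im; rewrite ltnW.
  rewrite !rmorphD !rmorphM /= !horner_algX !horner_algC.
  rewrite ![(_ + c%:A) * v]mulrDl; congr (_ + _).
  by rewrite -!mulrA vJ IHp.
have leftk v : left_killed m.+1 v -> left_killed m v.
  by move=> hv i j im jm; apply: hv; rewrite ltnS ltnW.
have rightk v : right_killed m.+1 v -> right_killed m v.
  by move=> hv i j im jm; apply: hv; rewrite ltnS ltnW.
exists (z * g); split.
- suff half (i j : 'I_n) : (i < m)%N -> (j < m.+1)%N -> i != j -> e i j * (z * g) = 0.
    move=> i j; rewrite ltnS leq_eqVlt => /orP[/eqP im|im]; last exact: half.
    rewrite ltnS leq_eqVlt => /orP[/eqP jm|jm] ij.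
      by case/eqP: ij; apply/val_inj; rewrite /= im jm.
    by rewrite eC half // ?im // eq_sym.
  move=> im; rewrite ltnS leq_eqVlt => /orP[/eqP jm|jm] ij; last by rewrite mulrA zl // mul0r.
  have -> : j = M by apply/val_inj.
  by rewrite zg (@brauer_contract_poly M i z (R * Q) mK im zl) QJ // mul0r mulr0.
- suff half (i j : 'I_n) : (i < m)%N -> (j < m.+1)%N -> i != j -> z * g * e i j = 0.
    move=> i j; rewrite ltnS leq_eqVlt => /orP[/eqP im|im]; last exact: half.
    rewrite ltnS leq_eqVlt => /orP[/eqP jm|jm] ij.
      by case/eqP: ij; apply/val_inj; rewrite /= im jm.
    by rewrite eC half // ?im // eq_sym.
  move=> im; rewrite ltnS leq_eqVlt => /orP[/eqP jm|jm] ij.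
    have -> : j = M by apply/val_inj.
    by rewrite (@brauer_poly_contract M i z (R * Q) mK im zr) QJ // mulr0 mul0r.
  by rewrite zg -mulrA zr // mulr0.
- move=> u u_rho u_e; apply: commrM.
    apply: z_comm => [s hs|i j im jm]; first by apply: u_rho; apply: low_permW hs.
    by apply: u_e; rewrite ltnS ltnW.
  apply: comm_horner; apply: comm_brauer_star => i im iM.
  split; first by apply: u_rho; apply: low_tperm => //; rewrite ltnW.
  by apply: u_e => //; rewrite ltnW.
- have fz : GRing.comm f z.
    apply: z_comm => [s hs|i j im jm ij]; first by apply: f_rho; apply: low_permW hs; rewrite ltnW.
    by have [] := f_e i j (ltn_trans im mK) (ltn_trans jm mK) ij.
  have fJ : I (f * (J - jucys M)).
    rewrite /J /brauer_jucys /brauer_star addrAC subrr add0r mulrN -mulN1r; apply: IM.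
    rewrite mulr_sumr; apply: (big_ind I) => // i /andP[]; rewrite inE => im iM.
    by have [] := f_e i M (ltn_trans im mK) mK iM.
  have fP : I (f * horner_alg J P).
    suff gen p : I (f * (horner_alg J p - horner_alg (jucys M) p)).
      by have := gen P; rewrite hC subr0.
    elim/poly_ind: p => [|p c IHp]; first by rewrite !rmorph0 subrr mulr0.
    rewrite !rmorphD !rmorphM /= !horner_algX !horner_algC.
    set pJ := horner_alg J p in IHp *; set pj := horner_alg (jucys M) p in IHp *.
    have -> : f * (pJ * J + c%:A - (pj * jucys M + c%:A)) =
        f * (pJ - pj) * J + f * pj * (J - jucys M).
      by Ncring_tac.non_commutative_ring.
    apply: ID (IMr _ _ IHp) _.
    have -> : f * pj = pj * f.
      apply: comm_horner; apply: comm_star => i im iM; apply: f_rho.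
      by apply: low_tperm => //; apply: ltn_trans mK.
    by rewrite -mulrA; apply: IM.
  (* As [1 - g] is [S P] evaluated at [J] and [f * horner_alg J P] lies in [I], passing from [z] to
     [z * g] changes [f * z] only within [I]. *)
  have -> : f * (1 - z * g) = f * (1 - z) + z * (f * horner_alg J P * horner_alg J S).
    rewrite gE mulrC rmorphM /= mulrA (mulrA z) -fz; Ncring_tac.non_commutative_ring.
  by apply: ID zI _; apply: IM; apply: IMr.
- split=> v hv.
    rewrite mulrA zr_id ?gE; last exact: rightk.
    by rewrite mulrC rmorphM /= mulrBr mulr1 mulrA aPJ // mul0r subr0.
  rewrite zg -mulrA zl_id ?gE; last exact: leftk.
  by rewrite rmorphM /= mulrBl mul1r -mulrA PJa // mulr0 subr0.
Qed.

End Brauer.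

(** * Primitive idempotents of the symmetric group *)

Section LinSpan.
Variables (F : fieldType) (V : lmodType F) (P : V -> Prop).

(** As an inductive predicate the span comes with an induction on generators, and it serves for
    subspaces and two-sided ideals alike. *)
Inductive lin_span : V -> Prop :=
| LinSpan0 : lin_span 0
| LinSpanD c a b of P a & lin_span b : lin_span (c *: a + b).

Lemma lin_span_gen a : P a -> lin_span a.
Proof. by move=> Pa; rewrite -[a]scale1r -[_ *: a]addr0; constructor=> //; constructor. Qed.

Lemma lin_spanD a b : lin_span a -> lin_span b -> lin_span (a + b).
Proof.
elim=> [|c u v Pu _ IH] hb; first by rewrite add0r.
by rewrite -addrA; constructor=> //; apply: IH.
Qed.

Lemma lin_spanZ c a : lin_span a -> lin_span (c *: a).
Proof.
elim=> [|d u v Pu _ IH]; first by rewrite scaler0; constructor.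
by rewrite scalerDr scalerA; constructor.
Qed.

Lemma lin_span_sum I (r : seq I) (Q : pred I) (f : I -> V) :
  (forall i, Q i -> lin_span (f i)) -> lin_span (\sum_(i <- r | Q i) f i).
Proof. by move=> h; apply: big_ind => //; [constructor|exact: lin_spanD]. Qed.

End LinSpan.

Lemma lin_span_mul (F : fieldType) (A : algType F) (P Q R : A -> Prop) a b :
    (forall u v, P u -> Q v -> lin_span R (u * v)) ->
  lin_span P a -> lin_span Q b -> lin_span R (a * b).
Proof.
move=> h ha hb; elim: ha => [|c u v Pu _ IH]; first by rewrite mul0r; constructor.
rewrite mulrDl -scalerAl; apply: lin_spanD => //; apply: lin_spanZ.
elim: hb => [|d w w' Qw _ IH']; first by rewrite mulr0; constructor.
by rewrite mulrDr -scalerAr; apply: lin_spanD => //; apply/lin_spanZ/h.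
Qed.

Lemma roots_poly_cons (F : fieldType) (c : F) rs :
  roots_poly (c :: rs) = ('X - c%:P) * roots_poly rs.
Proof. by rewrite /roots_poly big_cons. Qed.

(** Lagrange interpolation modulo [roots_poly rs], assembled one root at a time from Bezout
    relations; distinctness makes each [X - c] coprime to the rest. *)
Lemma partition_unity (F : fieldType) (rs : seq F) : uniq rs ->
  exists w : F -> {poly F}, roots_poly rs %| \sum_(c <- rs) w c - 1 /\
    forall c, c \in rs -> roots_poly rs %| ('X - c%:P) * w c.
Proof.
elim: rs => [|c rs IH] /=; first by exists (fun=> 0); rewrite /roots_poly big_nil dvd1p.
case/andP=> crs /IH [w [w1 w2]].
have /Bezout_eq1_coprimepP[[S R] /= SR] : coprimep ('X - c%:P) (roots_poly rs).
  by rewrite coprimep_sym coprimep_XsubC root_prod_XsubC.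
have wE d : d \in rs -> (d == c) = false.
  by move=> hd; apply: contraNF crs => /eqP <-.
exists (fun d => if d == c then R * roots_poly rs else S * ('X - c%:P) * w d); split.
  rewrite big_cons eqxx big_seq (eq_bigr (fun d => S * ('X - c%:P) * w d)) => [|d hd].
    rewrite -big_seq -mulr_sumr -SR roots_poly_cons.
    have -> : R * roots_poly rs + S * ('X - c%:P) * (\sum_(d <- rs) w d) -
        (S * ('X - c%:P) + R * roots_poly rs) =
        S * (('X - c%:P) * (\sum_(d <- rs) w d - 1)).
      by Ncring_tac.non_commutative_ring.
    by apply/dvdp_mull/dvdp_mul.
  by rewrite wE.
move=> d; rewrite inE => /orP[/eqP->|hd].
  by rewrite eqxx mulrCA roots_poly_cons dvdp_mull.
rewrite wE // -mulrA (mulrCA _ S) (mulrCA ('X - d%:P)) roots_poly_cons.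
by rewrite dvdp_mull // dvdp_mul ?w2.
Qed.

Section Eigenprojections.
Variables (F : fieldType) (A : algType F) (a : A) (rs : seq F).
Hypotheses (rs_uniq : uniq rs) (ha : horner_alg a (roots_poly rs) = 0).

Lemma horner_dvdp p : roots_poly rs %| p -> horner_alg a p = 0.
Proof. by move=> /dvdpP[q ->]; rewrite rmorphM /= ha mulr0. Qed.

Lemma eigenprojections : exists w : F -> {poly F},
  \sum_(c <- rs) horner_alg a (w c) = 1 /\
  forall c, c \in rs -> a * horner_alg a (w c) = c *: horner_alg a (w c).
Proof.
have [w [w1 w2]] := partition_unity rs_uniq; exists w; split.
  move/horner_dvdp: w1; rewrite rmorphB rmorph_sum rmorph1 /= => /eqP.
  by rewrite subr_eq0 => /eqP.
move=> c /w2/horner_dvdp; rewrite rmorphM /= horner_root mulrBl => /eqP.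
by rewrite subr_eq0 -scalerAl mul1r => /eqP.
Qed.

End Eigenprojections.

Lemma corner_inverse_pow (A : pzRingType) (e u y : A) k :
  e * e = e -> u * y = e -> e * y = y -> u ^+ k * (y ^+ k * e) = e.
Proof.
move=> ee uy ey; elim: k => [|k IH]; first by rewrite !expr0 !mul1r.
rewrite exprSr exprS -!mulrA (mulrA u y) uy; case: k IH => [|k] IH.
  by rewrite !expr0 !mul1r ee.
by rewrite [y ^+ k.+1]exprS -mulrA (mulrA e y) ey (mulrA y) -exprS.
Qed.

Section SymmetricGroup.
Variables (F : fieldType) (A : algType F) (n : nat).
Variable rho : 'S_n -> A.
Hypotheses (rho1 : rho 1%g = 1) (rhoM : forall s t, rho s * rho t = rho (s * t)%g).
Local Notation swap := (swap rho).
Local Notation jucys := (jucys rho).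

Definition perm_span k := lin_span (fun a => exists2 s, perm_on (low n k) s & a = rho s).

Lemma perm_span_rho k s : perm_on (low n k) s -> perm_span k (rho s).
Proof. by move=> hs; apply: lin_span_gen; exists s. Qed.

Lemma perm_span1 k : perm_span k 1.
Proof. by rewrite -rho1; apply/perm_span_rho/perm_on1. Qed.

Lemma perm_spanM k a b : perm_span k a -> perm_span k b -> perm_span k (a * b).
Proof.
apply: lin_span_mul => _ _ [s hs ->] [t ht ->].
by rewrite rhoM; apply/perm_span_rho/perm_onM.
Qed.

Lemma perm_spanW k l a : (k <= l)%N -> perm_span k a -> perm_span l a.
Proof.
move=> kl; elim=> [|c u v [s hs ->] _ IH]; first by constructor.
by apply: LinSpanD => //; exists s => //; apply: low_permW hs.
Qed.

Lemma perm_span_jucys k (m : 'I_n) : (m < k)%N -> perm_span k (jucys m).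
Proof.
move=> mk; apply: lin_span_sum => i /andP[]; rewrite inE => im _.
by apply/perm_span_rho/low_tperm => //; apply: ltn_trans mk.
Qed.

Lemma perm_span_horner k a p : perm_span k a -> perm_span k (horner_alg a p).
Proof.
move=> ha; elim/poly_ind: p => [|p c IHp]; first by rewrite rmorph0; constructor.
rewrite rmorphD rmorphM /= horner_algX horner_algC.
by apply: lin_spanD (lin_spanZ _ (perm_span1 _)); apply: perm_spanM.
Qed.

Lemma perm_span_comm k u a : (forall s, perm_on (low n k) s -> GRing.comm u (rho s)) ->
  perm_span k a -> GRing.comm u a.
Proof.
move=> hu; elim=> [|c v w [s hs ->] _ IH]; first exact: commr0.
apply: commrD => //; rewrite /GRing.comm -scalerAr -scalerAl; congr (_ *: _).
exact: hu.
Qed.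

Lemma perm_span_corner k (e f : A) : (forall s, perm_on (low n k) s -> exists c, e * rho s * e = c *: f) ->
  forall a, perm_span k a -> exists c, e * a * e = c *: f.
Proof.
move=> h a; elim=> [|c _ v [s hs ->] _ [d IH]].
  by exists 0; rewrite mulr0 mul0r scale0r.
have [d' hd'] := h s hs; exists (c * d' + d).
by rewrite mulrDr mulrDl IH -scalerAr -scalerAl hd' scalerA scalerDl.
Qed.

(** Twice the sum of the transpositions of the first [k] indices, each counted from both ends; by
    [central_succ], also twice the sum of the Jucys-Murphy elements of index below [k]. *)
Definition central k : A := \sum_(j in low n k) star swap k j.

Lemma central_rho k s : perm_on (low n k) s -> GRing.comm (central k) (rho s).
Proof.
move=> hs; rewrite /GRing.comm mulr_suml mulr_sumr [RHS](reindex_inj (@perm_inj _ s)) /=.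
apply: eq_big => j; first by rewrite low_perm.
by move=> _; apply: star_rho hs => i l; apply: swap_rho.
Qed.

Lemma star_succ (m j : 'I_n) : (j < m)%N -> star swap m.+1 j = star swap m j + swap m j.
Proof.
move=> jm; rewrite /star (bigD1 m) /=; last first.
  by rewrite inE ltnSn -val_eqE /= gtn_eqF.
rewrite addrC; congr (_ + _); apply: eq_bigl => i; rewrite !inE ltnS -(val_eqE i m) /=.
by case: ltngtP => //= _; rewrite ?andbT ?andbF.
Qed.

Lemma star_succ_diag (m : 'I_n) : star swap m.+1 m = jucys m.
Proof.
rewrite /jucys star1; apply: eq_bigl => i; rewrite inE -val_eqE /=.
by rewrite ltnS; case: ltngtP.
Qed.

Lemma central_succ (m : 'I_n) : central m.+1 = central m + jucys m *+ 2.
Proof.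
rewrite /central (bigD1 m) ?inE ?ltnSn //= star_succ_diag mulr2n [RHS]addrC -addrA.
congr (_ + _); rewrite {1}/jucys star1.
have -> : \sum_(j in low n m) star swap m j = \sum_(i < n | (i < m)%N) star swap m i.
  by apply: eq_bigl => i; rewrite inE.
rewrite -big_split; apply: eq_big => [i|i /andP[]].
  by rewrite inE ltnS -val_eqE /=; case: ltngtP.
rewrite inE ltnS leq_eqVlt => /orP[/eqP/val_inj->|im _]; first by rewrite eqxx.
by rewrite star_succ // addrC swapC.
Qed.

Lemma low_perm_double_coset (m m' : 'I_n) (s : 'S_n) : m' = m.+1 :> nat ->
  perm_on (low n m'.+1) s ->
  perm_on (low n m') s \/ exists a b, [/\ perm_on (low n m') a, perm_on (low n m') b &
    s = (a * tperm m m' * b)%g].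
Proof.
move=> mm hs.
have fix_on t : perm_on (low n m'.+1) t -> t m' = m' -> perm_on (low n m') t.
  move=> ht tm; apply/subsetP => i; rewrite !inE => ti; have := subsetP ht i; rewrite !inE.
  move=> /(_ ti); rewrite ltnS leq_eqVlt => /orP[/eqP/val_inj im|//].
  by rewrite im tm eqxx in ti.
have [sm|sm] := eqVneq (s m') m'; first by left; apply: fix_on.
right; have jm : (s m' < m')%N.
  have := low_perm m' hs; rewrite !inE ltnSn ltnS leq_eqVlt.
  by rewrite val_eqE (negbTE sm) /= => ->.
have mm' : (m < m')%N by rewrite mm.
(* Permutations compose from left to right: the three factors of [a] send [m'] to [s m'], then to
   [m], then back to [m']. *)
pose b := tperm m (s m'); pose a := (s * b^-1 * (tperm m m')^-1)%g.
exists a, b; split; last by rewrite /a !mulgKV.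
- apply: fix_on; last by rewrite /a !permM !tpermV tpermR tpermL.
  rewrite /a !tpermV; do 2?apply: perm_onM => //; apply: low_tperm => //.
  + by rewrite ltnS ltnW.
  + by rewrite ltnS ltnW.
  + by rewrite ltnS ltnW.
- exact: low_tperm.
Qed.

(* [zeta] records the sum of the Jucys-Murphy eigenvalues (doubled), a central
   character. *)
Definition jucys_family (m : 'I_n) (T : finType) (E : T -> A) (zeta : T -> F) : Prop :=
  [/\ \sum_i E i = 1, forall i j, i != j -> E i * E j = 0, forall i, perm_span m.+1 (E i) &
   [/\ forall i s, perm_on (low n m.+1) s -> exists c, E i * rho s * E i = c *: E i,
       forall i, central m.+1 * E i = zeta i *: E i,
       forall i j (m' : 'I_n), m' = m.+1 :> nat -> i != j ->
         zeta i <> zeta j \/ E i * swap m m' * E j = 0 &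
       forall i, exists c, jucys m * E i = c *: E i /\ E i * jucys m = c *: E i]].

Hypothesis two_neq0 : 2 != 0 :> F.
Hypothesis semiprime : forall k a, perm_span k a ->
  (forall s, perm_on (low n k) s -> a * rho s * a = 0) -> a = 0.

Section Step.
Variables (m m' : 'I_n) (T : finType) (E : T -> A) (zeta : T -> F).
Hypotheses (mm : m' = m.+1 :> nat) (fam : jucys_family m E zeta).
Local Notation J := (jucys m').

Let sumE : \sum_i E i = 1. Proof. by case: fam. Qed.
Let orthE i j : i != j -> E i * E j = 0. Proof. by case: fam => _ + _ _; apply. Qed.
Let spanE i : perm_span m' (E i). Proof. by rewrite mm; case: fam => _ _ + _; apply. Qed.

Let idemE i : E i * E i = E i.
Proof.
rewrite -[RHS]mulr1 -sumE mulr_sumr (bigD1 i) //= big1 ?addr0 // => j ji.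
by rewrite orthE // eq_sym.
Qed.

Let JE i : GRing.comm J (E i).
Proof. by apply: perm_span_comm (spanE i) => s; apply: jucys_rho. Qed.

Let pJE p i : GRing.comm (horner_alg J p) (E i).
Proof. by apply/commr_sym/comm_horner/commr_sym. Qed.

(* The relation [J_m' s = s J_m + 1] makes [E i * s * E i] the inverse of [J_m' - c]
   on [E i]. *)
Lemma swap_corner i : exists p, E i * swap m m' * E i = horner_alg J p * E i.
Proof.
have [_ _ _ [_ _ _ /(_ i)[c [aE Ea]]]] := fam.
have ss := swap_sq rho1 rhoM m m'.
have bE := jucys_succ rho1 rhoM mm.
set s := swap m m' in ss bE *; set a := jucys m in aE Ea bE; set b := J in bE *.
have bs : b * s = s * a + 1 by rewrite bE mulrDl -mulrA ss mulr1.
have sb : s * b = a * s + 1 by rewrite bE mulrDr !mulrA ss mul1r.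
pose y := E i * s * E i; pose u := b - c%:A.
have uy : u * y = E i.
  rewrite /u /y mulrBl -scalerAl mul1r !mulrA JE -(mulrA (E i) b) bs.
  rewrite mulrDr mulr1 mulrDl -!mulrA aE -!scalerAr idemE.
  by rewrite addrAC subrr add0r.
have Ey : E i * y = y by rewrite /y !mulrA idemE.
have yE : y * E i = y by rewrite /y -!mulrA idemE.
have powy k := corner_inverse_pow k (idemE i) uy Ey.
have [C hC] := jucys_poly rho1 rhoM m'.
(* As [y] inverts [u] on [E i], the power of [X - c] can be cancelled and the cofactor [g] already
   annihilates [E i]. Bezout for [g] and [X - c] then turns the inverse [y] into [R] evaluated at
   [b], times [E i]. *)
have [k [g gc Pg]] := multiplicity_XsubC (int_roots F C) c.
have P0 : int_roots F C != 0 by apply/monic_neq0/monic_prod_XsubC.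
rewrite P0 /= in gc.
have gE : horner_alg b g * E i = 0.
  have gu : horner_alg b g * u ^+ k = 0.
    by rewrite -hC Pg rmorphM rmorphXn /= horner_root.
  by rewrite -(powy k) (mulrA _ (u ^+ k)) gu mul0r.
have /Bezout_eq1_coprimepP[[S R] /= SR] : coprimep g ('X - c%:P).
  by rewrite coprimep_XsubC.
exists R; rewrite -/y -[LHS]mul1r -(rmorph1 (horner_alg b)) -SR rmorphD !rmorphM /=.
have gy : horner_alg b g * y = 0 by rewrite -Ey mulrA gE mul0r.
by rewrite horner_root -/u mulrDl -!(mulrA _ _ y) gy mulr0 add0r uy.
Qed.

Let ortho i j a : zeta i <> zeta j -> perm_span m' a -> E i * a * E j = 0.
Proof.
move=> ij ha; have [_ _ _ [_ cE _ _]] := fam; rewrite -mm in cE.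
have cC u : perm_span m' u -> GRing.comm (central m') u.
  by apply: perm_span_comm => s; apply: central_rho.
have : zeta i *: (E i * a * E j) = zeta j *: (E i * a * E j).
  transitivity (E i * central m' * a * E j).
    by rewrite -(cC _ (spanE i)) cE -!scalerAl.
  by rewrite -(mulrA (E i) _ a) cC // -!mulrA cE -!scalerAr.
move/eqP; rewrite -subr_eq0 -scalerBl scaler_eq0 subr_eq0 => /orP[/eqP //|/eqP //].
Qed.

(** In a double coset [a s b], the sum of all [E j] is inserted on either side of [s]. In a mixed
    term either [E k s E j = 0], or [zeta k] and [zeta j] differ, so that one of them differs from
    [zeta i] and [ortho] applies. A diagonal term is a polynomial in [J] by [swap_corner]; [J]
    commutes with the smaller group, and what remains is a scalar multiple of [E i]. *)
Lemma corner_next i s : perm_on (low n m'.+1) s ->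
  exists p, E i * rho s * E i = horner_alg J p * E i.
Proof.
have [_ _ _ [cornE _ sepE _]] := fam; rewrite -mm in cornE.
have cE j a : perm_span m' a -> exists c, E j * a * E j = c *: E j.
  by move: a; apply: perm_span_corner => t; apply: cornE.
case/(low_perm_double_coset mm) => [hs|[a [b [ha hb ->]]]].
  have [c ->] := cornE i s hs; exists c%:P.
  by rewrite horner_algC -scalerAl mul1r.
rewrite -!rhoM.
have -> : E i * (rho a * rho (tperm m m') * rho b) * E i =
    \sum_j E i * rho a * E j * swap m m' * E j * rho b * E i.
  transitivity (E i * rho a * (\sum_j E j) * swap m m' * (\sum_j E j) * rho b * E i).
    by rewrite !sumE !mulr1 !mulrA.
  rewrite mulr_sumr !mulr_suml; apply: eq_bigr => j _.
  rewrite !mulr_sumr !mulr_suml (bigD1 j) //= big1 ?addr0 // => k kj.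
  have [kjz|h] := sepE k j m' mm kj.
    have [ik|ik] := eqVneq (zeta i) (zeta k); last first.
      have h0 : E i * rho a * E k = 0.
        by apply: ortho; [apply/eqP|apply: perm_span_rho].
      by rewrite h0 !mul0r.
    have ji : zeta j <> zeta i by rewrite ik => /esym.
    have h0 : E j * rho b * E i = 0 by apply: ortho ji _; apply: perm_span_rho.
    by rewrite -(mulrA _ (rho b)) -(mulrA _ (E j)) (mulrA (E j)) h0 mulr0.
  by rewrite -(mulrA _ (swap m m')) -(mulrA _ (E k)) (mulrA (E k)) h mulr0 !mul0r.
apply: (big_ind (fun y => exists p, y = horner_alg J p * E i)) => [|_ _ [p ->] [q ->]|j _].
- by exists 0; rewrite rmorph0 mul0r.
- by exists (p + q); rewrite rmorphD mulrDl.
have [p hp] := swap_corner j.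
have [c hc] : exists c, E i * (rho a * E j * rho b) * E i = c *: E i.
  by apply: cE; apply: perm_spanM; [apply: perm_spanM|]; rewrite ?spanE //; apply: perm_span_rho.
exists (c%:P * p).
have -> : E i * rho a * E j * swap m m' * E j * rho b * E i =
    E i * rho a * (E j * swap m m' * E j) * rho b * E i by rewrite !mulrA.
rewrite hp rmorphM /= horner_algC.
have pc u : perm_span m' u -> GRing.comm (horner_alg J p) u.
  move=> hu; apply/commr_sym/comm_horner/commr_sym.
  by apply: perm_span_comm hu => t; apply: jucys_rho.
have -> : E i * rho a * (horner_alg J p * E j) * rho b * E i =
    horner_alg J p * (E i * (rho a * E j * rho b) * E i).
  rewrite (mulrA _ (horner_alg J p)) -(pc (E i * rho a)) ?mulrA //.
  by apply: perm_spanM; [exact: spanE|exact: perm_span_rho].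
by rewrite hc -scalerAr -!scalerAl mul1r.
Qed.

(* [E i F[S_(k+1)] E i] is contained in [F[J] E i], which is commutative, hence
   reduced by semiprimality. *)
Lemma jucys_squarefree : exists2 rs, uniq rs & horner_alg J (roots_poly rs) = 0.
Proof.
have [C hC] := jucys_poly rho1 rhoM m'.
rewrite /int_roots in hC; set D := map _ C in hC; exists (undup D); first exact: undup_uniq.
rewrite -[LHS]mulr1 -sumE mulr_sumr big1 // => i _.
set r := horner_alg J (roots_poly (undup D)).
have rE : GRing.comm r (E i) by apply: pJE.
have rp p : GRing.comm r (horner_alg J p).
  by apply: comm_horner; apply/commr_sym/comm_horner.
have nil : r ^+ size D = 0.
  have /dvdpP[q qE] : roots_poly D %| roots_poly (undup D) ^+ size D.
    suff gen D' : {subset D' <= undup D} ->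
        roots_poly D' %| roots_poly (undup D) ^+ size D'.
      by apply: gen => c; rewrite mem_undup.
    elim: D' => [|c D' IH] sub; first by rewrite /roots_poly big_nil dvd1p.
    rewrite roots_poly_cons /= exprS dvdp_mul //.
      by rewrite dvdp_XsubCl root_prod_XsubC sub ?mem_head.
    by apply: IH => d hd; apply: sub; rewrite inE hd orbT.
  by rewrite -(rmorphXn (horner_alg J)) /= qE rmorphM /= hC mulr0.
(* For [k >= 1] the sandwich [r^k E s r^k E] contains [r^(2k)] and vanishes once [r^(k+1) E = 0];
   semiprimality thus lowers the exponent down to 1. *)
have step k : (0 < k)%N -> r ^+ k.+1 * E i = 0 -> r ^+ k * E i = 0.
  move=> k0 rk; apply: (semiprime (k := m'.+1)).
    apply: perm_spanM; last by apply: perm_spanW (spanE i).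
    rewrite -(rmorphXn (horner_alg J)); apply/perm_span_horner/perm_span_jucys.
    exact: ltnSn.
  move=> s hs; have [p hp] := corner_next i hs.
  have rkE l : GRing.comm (r ^+ l) (E i) by apply/commr_sym/commrX/commr_sym.
  transitivity (r ^+ k * (E i * rho s * E i) * r ^+ k).
    by rewrite -!mulrA -rkE.
  have rkp : r ^+ k * horner_alg J p = horner_alg J p * r ^+ k.
    by apply/esym/commrX/commr_sym/rp.
  rewrite hp -!mulrA -rkE (mulrA (r ^+ k)) rkp -mulrA (mulrA (r ^+ k)) -exprD.
  case: k k0 rk {rkp} => // k _ rk; rewrite addSnnS exprD -(mulrA (r ^+ k)) rk.
  by rewrite !mulr0.
suff [k [k0 rk]] : exists k, (k <= 1)%N /\ r ^+ k * E i = 0.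
  by case: k k0 rk => [|[|]] //= _; rewrite ?expr0 ?mul1r => h; rewrite ?h ?mulr0 // -(expr1 r).
have : r ^+ size D * E i = 0 by rewrite nil mul0r.
elim: (size D) => [|[|k] IH] h; [by exists 0|by exists 1|apply: IH].
exact: step.
Qed.

(** Each [E i] is cut by the eigenprojections [Q k] of [J]. Distinct pieces of the same [E i] get
    distinct [zeta]. Pieces of different [E i] and [E j] are separated by the next transposition: it
    commutes with the smaller group, so it moves past [E j] and leaves [E i * E j = 0]. *)
Lemma jucys_family_succ :
  exists (T' : finType) (E' : T' -> A) (zeta' : T' -> F), jucys_family m' E' zeta'.
Proof.
have [rs rs_uniq hJ] := jucys_squarefree.
have [w [w1 w2]] := eigenprojections rs_uniq hJ.
pose c (k : 'I_(size rs)) := rs`_k.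
pose Q k := horner_alg J (w (c k)).
have sumQ : \sum_k Q k = 1 by rewrite -w1 (big_nth 0) big_mkord.
have JQ k : J * Q k = c k *: Q k by apply/w2/mem_nth.
have QE k i : GRing.comm (Q k) (E i) by apply: pJE.
have QQ k p : GRing.comm (horner_alg J p) (Q k).
  by apply: comm_horner; apply/commr_sym/comm_horner.
have pQ p k : horner_alg J p * Q k = p.[c k] *: Q k.
  elim/poly_ind: p => [|p d IH]; first by rewrite rmorph0 horner0 mul0r scale0r.
  rewrite rmorphD rmorphM /= horner_algX horner_algC hornerMXaddC mulrDl -mulrA JQ.
  by rewrite -scalerAr IH scalerA mulrC -scalerAl mul1r scalerDl.
have cI k l : k != l -> c k != c l by move=> kl; rewrite /c nth_uniq.
have Qorth k l : k != l -> Q k * Q l = 0.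
  move=> kl; have : c k *: (Q k * Q l) = c l *: (Q k * Q l).
    rewrite scalerAl -JQ scalerAr -JQ mulrA; congr (_ * _).
    exact: comm_horner.
  move/eqP; rewrite -subr_eq0 -scalerBl scaler_eq0 subr_eq0 (negbTE (cI _ _ kl)) /=.
  by move/eqP.
have Qidem k : Q k * Q k = Q k.
  rewrite -[RHS]mulr1 -sumQ mulr_sumr (bigD1 k) //= big1 ?addr0 // => l lk.
  by rewrite Qorth // eq_sym.
have [_ _ _ [cornE cE sepE _]] := fam; rewrite -mm in cornE cE.
have spanEQ i k : perm_span m'.+1 (E i * Q k).
  apply: perm_spanM; first by apply: perm_spanW (spanE i).
  by apply/perm_span_horner/perm_span_jucys.
exists (T * 'I_(size rs))%type, (fun t => E t.1 * Q t.2), (fun t => zeta t.1 + c t.2 *+ 2).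
split; [| |by case=> i k; apply: spanEQ|split].
- rewrite -(pair_bigA _ (fun i k => E i * Q k)) /= -[RHS]sumE; apply: eq_bigr => i _.
  by rewrite -mulr_sumr sumQ mulr1.
- case=> i k [j l] /= ne; rewrite -mulrA (mulrA (Q k)) QE !mulrA.
  have [ij|ij] := eqVneq i j; last by rewrite orthE // !mul0r.
  rewrite -(mulrA _ (Q k)) Qorth ?mulr0 //.
  by apply: contraNneq ne => kl; rewrite ij kl.
- case=> i k s hs /=; have [p hp] := corner_next i hs; exists p.[c k].
  transitivity (Q k * (E i * rho s * E i) * Q k); first by rewrite !mulrA QE.
  rewrite hp mulrA -QQ -mulrA -QE -(mulrA _ (Q k)) (mulrA (Q k)) Qidem mulrA pQ.
  by rewrite -scalerAl QE.
- case=> i k /=; rewrite central_succ mulrDl mulrA cE -scalerAl scalerDl; congr (_ + _).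
  rewrite mulrnAl mulrA JE -mulrA JQ -scalerAr.
  by rewrite -scaler_nat scalerA -[c k *+ 2]mulr_natl.
- case=> i k [j l] m'' mm'' /= ne.
  have [ij|ij] := eqVneq i j.
    left; rewrite ij => /addrI /eqP; rewrite -subr_eq0 -mulrnBl -mulr_natr mulf_eq0.
    rewrite (negbTE two_neq0) orbF subr_eq0 => /eqP/eqP; apply/negP/cI.
    by apply: contraNneq ne => ->; rewrite ij.
  right; have sE u : perm_span m' u -> GRing.comm (swap m' m'') u.
    apply: perm_span_comm => s hs; rewrite /GRing.comm swap_rho //.
    by rewrite !(low_fix hs) // mm''.
  have -> : E i * Q k * swap m' m'' * (E j * Q l) = Q k * (E i * (swap m' m'' * E j)) * Q l.
    by rewrite -QE -!mulrA.
  by rewrite sE // mulrA orthE // mul0r mulr0 mul0r.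
- case=> i k /=; exists (c k); split.
    by rewrite mulrA JE -mulrA JQ -scalerAr.
  have := QQ k 'X; rewrite horner_algX /GRing.comm => JQ'.
  by rewrite -mulrA -JQ' JQ scalerAr.
Qed.

End Step.

Lemma low1_perm k (s : 'S_n) : (k <= 1)%N -> perm_on (low n k) s -> s = 1%g.
Proof.
move=> k1 /(low_permW k1) hs; apply/permP => i; rewrite perm1; apply/val_inj.
have [i1|i1] := ltnP i 1; last by rewrite (low_fix hs).
have := low_perm i hs; rewrite !inE i1 /= => si; lia.
Qed.

Lemma jucys_family_exists (m : 'I_n) :
  exists (T : finType) (E : T -> A) (zeta : T -> F), jucys_family m E zeta.
Proof.
case: m; elim=> [|m IHm] mn; last first.
  have [T [E [zeta fam]]] := IHm (ltnW mn).
  exact: (@jucys_family_succ (Ordinal (ltnW mn)) (Ordinal mn) T E zeta erefl fam).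
exists unit, (fun=> 1), (fun=> 0); split=> [|[] []//|_|]; last split.
- by rewrite big_const card_unit /= addr0.
- exact: perm_span1.
- move=> _ s /(low1_perm (leqnn 1)) ->; exists 1.
  by rewrite rho1 !mul1r scale1r.
- move=> _; rewrite scale0r mulr1; apply: big1 => j; rewrite inE /= ltnS leqn0 => /eqP j0.
  apply: big1 => i /andP[]; rewrite inE /= ltnS leqn0 => /eqP i0.
  by rewrite -val_eqE /= i0 j0.
- by move=> [] [].
- move=> _; exists 0; rewrite scale0r mulr1 mul1r /jucys star1 big1 //.
Qed.

Lemma perm_corner_family k : (k <= n)%N ->
  exists (T : finType) (E : T -> A), [/\ \sum_i E i = 1, forall i, perm_span k (E i) &
    forall i a, perm_span k a -> exists c, E i * a * E i = c *: E i].
Proof.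
case: k => [|k] kn.
  exists unit, (fun=> 1); split=> [|_|_].
  - by rewrite big_const card_unit /= addr0.
  - exact: perm_span1.
  - apply: perm_span_corner => s /(low1_perm (leq0n 1)) ->; exists 1.
    by rewrite rho1 !mul1r scale1r.
have [T [E [zeta [h1 _ h2 [h3 _ _ _]]]]] := jucys_family_exists (Ordinal kn).
by exists T, E; split=> // i; apply: perm_span_corner => s; apply: h3.
Qed.

Definition perm_ideal k T (E : T -> A) (Y : pred T) := lin_span (fun a =>
  exists i s t, [/\ Y i, perm_on (low n k) s, perm_on (low n k) t & a = rho s * E i * rho t]).

Lemma perm_idealM k T (E : T -> A) (Y : pred T) u a v :
  perm_span k u -> perm_ideal k E Y a -> perm_span k v -> perm_ideal k E Y (u * a * v).
Proof.
move=> hu ha hv; have hua : perm_ideal k E Y (u * a).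
  apply: lin_span_mul hu ha => _ _ [s hs ->] [i [s' [t [Yi hs' ht ->]]]].
  apply: lin_span_gen; exists i, (s * s')%g, t.
  by split=> //; [exact: perm_onM|rewrite -rhoM !mulrA].
apply: lin_span_mul hua hv => _ _ [i [s' [t [Yi hs' ht ->]]]] [s hs ->].
apply: lin_span_gen; exists i, s', (t * s)%g.
by split=> //; [exact: perm_onM|rewrite -rhoM !mulrA].
Qed.

(** [Y] is chosen greedily. If some [E i * rho s * E j * rho t * E i] with [j] in [Y] is nonzero, it
    is a nonzero multiple of [E i], which thus lies in the ideal of [E j]. Otherwise semiprimality
    makes [E i] orthogonal to all members of [Y], and [i] joins [Y]. *)
Lemma perm_primitives k : (k <= n)%N ->
  exists (T : finType) (Y : pred T) (E : T -> A),
    [/\ forall i, perm_span k (E i),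
        forall i a, perm_span k a -> exists c, E i * a * E i = c *: E i,
        forall i j a, Y i -> Y j -> i != j -> perm_span k a -> E i * a * E j = 0 &
        perm_ideal k E Y 1].
Proof.
move=> kn; have [T [E [sumE spanE cornE]]] := perm_corner_family kn.
suff [Y [orthY genY]] : exists Y : pred T,
    (forall i j s, Y i -> Y j -> i != j -> perm_on (low n k) s -> E i * rho s * E j = 0) /\
    (forall i, i \in enum T -> perm_ideal k E Y (E i)).
  exists T, Y, E; split=> // [i j a Yi Yj ij|].
    elim=> [|c _ u [s hs ->] _ IH]; first by rewrite mulr0 mul0r.
    by rewrite mulrDr mulrDl IH -scalerAr -scalerAl orthY // scaler0 addr0.
  by rewrite -sumE; apply: lin_span_sum => i _; apply: genY; rewrite mem_enum.
elim: (enum T) => [|i L [Y [orthY genY]]]; first by exists pred0.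
pose linked j := [exists s, exists t, [&& perm_on (low n k) s, perm_on (low n k) t &
  E i * rho s * E j * rho t * E i != 0]].
have [/existsP[j /andP[Yj /existsP[s /existsP[t /and3P[hs ht nz]]]]]|no] :=
    boolP [exists j, Y j && linked j].
  exists Y; split=> // l; rewrite inE => /orP[/eqP ->|]; last exact: genY.
  have [c hc] : exists c, E i * (rho s * E j * rho t) * E i = c *: E i.
    by apply: cornE; do 2?apply: perm_spanM; rewrite ?spanE //; apply: perm_span_rho.
  have c0 : c != 0.
    by apply: contraNneq nz => c0; rewrite -!mulrA in hc *; rewrite hc c0 scale0r.
  have -> : E i = c^-1 *: (E i * (rho s * E j * rho t) * E i).
    by rewrite hc scalerA mulVf // scale1r.
  apply/lin_spanZ/perm_idealM => //; apply: lin_span_gen; by exists j, s, t.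
exists (predU1 i Y); split; last first.
  have up a : perm_ideal k E Y a -> perm_ideal k E (predU1 i Y) a.
    elim=> [|c _ v [j [s [t [Yj hs ht ->]]]] _ IH]; first by constructor.
    by apply: LinSpanD => //; exists j, s, t; split=> //=; rewrite Yj orbT.
  move=> l; rewrite inE => /orP[/eqP ->|/genY/up //].
  apply: lin_span_gen; exists i, 1%g, 1%g; split; rewrite ?perm_on1 //=.
    by rewrite eqxx.
  by rewrite rho1 mul1r mulr1.
have unlinked j s t : Y j -> perm_on (low n k) s -> perm_on (low n k) t ->
    E i * rho s * E j * rho t * E i = 0.
  move=> Yj hs ht; apply/eqP; apply: contraNT no => nz.
  by apply/existsP; exists j; rewrite Yj; apply/existsP; exists s; apply/existsP; exists t;
    rewrite hs ht.
have ij0 j s : Y j -> perm_on (low n k) s -> E i * rho s * E j = 0.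
  move=> Yj hs; apply: (semiprime (k := k)).
    by do 2?apply: perm_spanM; rewrite ?spanE //; apply: perm_span_rho.
  by move=> t ht; rewrite !mulrA unlinked // !mul0r.
have ji0 j s : Y j -> perm_on (low n k) s -> E j * rho s * E i = 0.
  move=> Yj hs; apply: (semiprime (k := k)).
    by do 2?apply: perm_spanM; rewrite ?spanE //; apply: perm_span_rho.
  move=> t ht; have := unlinked j t s Yj ht hs => h.
  by rewrite -!mulrA; rewrite -!mulrA in h; rewrite h !mulr0.
move=> j l s /= /predU1P[->|Yj] /predU1P[->|Yl] jl hs.
- by rewrite eqxx in jl.
- exact: ij0.
- exact: ji0.
- exact: orthY.
Qed.

End SymmetricGroup.

(** * A criterion for split semisimplicity *)

Section SplitCriterion.
Variables (F : fieldType) (A : falgType F) (T : finType) (eps : T -> A).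
Hypothesis eps_corner : forall i a, exists c, eps i * a * eps i = c *: eps i.
Hypothesis eps_orth : forall i j a, i != j -> eps i * a * eps j = 0.
Hypothesis eps_full : lin_span (fun a => exists i u v, a = u * eps i * v) 1.

Let U i : {vspace A} := limg (amull (eps i)).
Let d i := \dim (U i).
Let X i := vbasis (U i).

Let memU i y : reflect (exists v, y = eps i * v) (y \in U i).
Proof.
apply: (iffP memv_imgP) => [[v _ ->]|[v ->]]; first by exists v; rewrite lfunE.
by exists v; rewrite ?memvf // lfunE.
Qed.

Let memU_mul i y a : y \in U i -> y * a \in U i.
Proof. by case/memU => v ->; apply/memU; exists (v * a); rewrite mulrA. Qed.

Let memX i k : (X i)`_k \in U i.
Proof.
have [kd|kd] := ltnP k (d i); first by apply/vbasis_mem/mem_nth; rewrite size_tuple.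
by rewrite nth_default ?mem0v // size_tuple.
Qed.

Let expand i y : y \in U i -> y = \sum_k coord (X i) k y *: (X i)`_k.
Proof. exact: coord_vbasis. Qed.

Let coordX i (c : 'I_(d i) -> F) k : coord (X i) k (\sum_l c l *: (X i)`_l) = c k.
Proof. by apply: coord_sum_free; apply: basis_free (vbasisP _). Qed.

(* The [i]-th block is the right action on the right ideal [eps i * A]. *)
Definition block_repr i (a : A) : 'M[F]_(d i) :=
  \matrix_(k, l) coord (X i) l ((X i)`_k * a).

Let block_reprE i a (k : 'I_(d i)) : (X i)`_k * a = \sum_l block_repr i a k l *: (X i)`_l.
Proof. by rewrite [LHS](@expand i) ?memU_mul //; apply: eq_bigr => l _; rewrite mxE. Qed.

Lemma block_repr_linear i : linear (block_repr i).
Proof.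
move=> c a b; apply/matrixP => k l.
by rewrite !mxE mulrDr linearD /= -scalerAr linearZ.
Qed.

Lemma block_reprM i a b : block_repr i (a * b) = block_repr i a *m block_repr i b.
Proof.
apply/matrixP => k l; rewrite !mxE mulrA block_reprE mulr_suml.
under eq_bigr do rewrite -scalerAl block_reprE.
rewrite linear_sum; apply: eq_bigr => m _; rewrite linearZ /=; congr (_ * _).
exact: coordX.
Qed.

Lemma block_repr_inj a b : (forall i, block_repr i a = block_repr i b) -> a = b.
Proof.
move=> h; have eqU i y : y \in U i -> y * a = y * b.
  move/expand ->; rewrite !mulr_suml; apply: eq_bigr => k _.
  by rewrite -!scalerAl !block_reprE h.
rewrite -[a]mul1r -[b]mul1r; elim: eps_full => [|c _ w [i [u [v ->]]] _ IH].
  by rewrite !mul0r.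
rewrite !mulrDl IH -!scalerAl -!mulrA; congr (_ *: (_ * _) + _).
by rewrite !mulrA; apply/eqU/memU; exists v.
Qed.

Lemma block_repr_surj (M : forall i, 'M[F]_(d i)) : exists a, forall i, block_repr i a = M i.
Proof.
pose act i y := \sum_k coord (X i) k y *: \sum_l M i k l *: (X i)`_l.
have actD i y z : act i (y + z) = act i y + act i z.
  by rewrite -big_split; apply: eq_bigr => k _; rewrite linearD scalerDl.
have actZ i c y : act i (c *: y) = c *: act i y.
  by rewrite scaler_sumr; apply: eq_bigr => k _; rewrite linearZ /= scalerA.
have actU i y : act i y \in U i.
  by apply: memv_suml => k _; apply/memvZ/memv_suml => l _; apply/memvZ/memX.
have act0 i : act i 0 = 0 by have := actZ i 0 0; rewrite !scale0r.
(* The factor [1] is kept for an induction on its expression as a sum of terms [u * eps j * v]. Each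
   contributes [u * act j (eps j * v)]: for [y] in [U j], left multiplication by [y * u] is a scalar
   on [U j] by [eps_corner]. *)
suff [a ha] : exists a, forall i y, y \in U i -> y * a = act i (y * 1).
  exists a => i; apply/matrixP => k l; rewrite mxE (ha i) ?memX // mulr1.
  have -> : act i (X i)`_k = \sum_l M i k l *: (X i)`_l; last exact: coordX.
  rewrite /act (bigD1 k) //= [X in _ + X]big1 ?addr0 => [|k' kk'].
    by rewrite coord_free ?(basis_free (vbasisP _)) // eqxx scale1r.
  by rewrite coord_free ?(basis_free (vbasisP _)) // eq_sym (negbTE kk') scale0r.
elim: eps_full => [|c _ w [j [u [v ->]]] _ [a ha]].
  by exists 0 => i y _; rewrite !mulr0 act0.
exists (c *: (u * act j (eps j * v)) + a) => i y yU.
rewrite !mulrDr actD (ha i) // -!scalerAr actZ; congr (_ *: _ + _).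
have /memU[t tE] : act j (eps j * v) \in U j by apply: actU.
case/memU: yU => z ->; have [->|ij] := eqVneq i j; last first.
  by rewrite tE !mulrA -(mulrA _ z u) eps_orth // !mul0r act0.
have [l hl] := eps_corner j (z * u).
have collapse b : eps j * z * (u * (eps j * b)) = l *: (eps j * b).
  by rewrite scalerAl -hl !mulrA.
by rewrite {1}tE collapse -tE -(mulrA u) collapse actZ.
Qed.

(** An [eps i] may be zero; its block then consists of matrices of size zero. *)
Theorem split_criterion : exists (k : nat) (d : 'I_k -> nat)
    (phi : forall i : 'I_k, A -> 'M[F]_(d i)),
  [/\ forall i, linear (phi i), forall i a b, phi i (a * b) = phi i a *m phi i b,
      forall a b, (forall i, phi i a = phi i b) -> a = b
    & forall M : (forall i : 'I_k, 'M[F]_(d i)), exists a, forall i, phi i a = M i].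
Proof.
exists #|T|, (fun i => d (enum_val i)), (fun i => block_repr (enum_val i)).
split=> [i|i|a b h|M]; [exact: block_repr_linear|exact: block_reprM| |].
  by apply: block_repr_inj => i; rewrite -(enum_rankK i).
(* The blocks are numbered by ordinals, so [M] is transported to a family over [T]; the transport is
   trivial on [enum_val i] by uniqueness of equality proofs. *)
have [N hN] : exists N : (forall i : T, 'M[F]_(d i)), forall i, N (enum_val i) = M i.
  pose N i : 'M[F]_(d i) := ecast j 'M[F]_(d j) (enum_rankK i) (M (enum_rank i)).
  exists N => i; rewrite /N; move: (enum_rankK _); rewrite enum_valK => e.
  by rewrite eq_axiomK.
by have [a ha] := block_repr_surj N; exists a => i; rewrite ha.
Qed.

End SplitCriterion.

(** * The group algebra is semiprime *)

(** Write [M = C R] with [C] left invertible and [R] right invertible: [M M = 0] forces [R C = 0],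
    and [R C] has the trace of [M]. *)
Lemma mxtrace_sq0 (F : fieldType) m (M : 'M[F]_m) : M *m M = 0 -> \tr M = 0.
Proof.
move=> MM; have e : col_base M *m (row_base M *m col_base M) *m row_base M = 0.
  by rewrite mulmxA mulmx_base -mulmxA mulmx_base.
have /row_freeP[R' hR] := row_base_free M; have /row_fullP[C' hC] := col_base_full M.
rewrite -(mulmx_base M) mxtrace_mulC.
have -> : row_base M *m col_base M =
    C' *m (col_base M *m (row_base M *m col_base M) *m row_base M) *m R'.
  by rewrite -mulmxA -(mulmxA (_ *m _) (row_base M)) hR mulmx1 mulmxA hC mul1mx.
by rewrite e mulmx0 mul0mx mxtrace0.
Qed.

Section Semiprime.
Variables (F : fieldType) (n : nat) (x : F).
Local Notation A := (rook_brauer n x).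
Hypothesis char0 : [pchar F] =i pred0.
Local Notation rho := (@rho F n x).

Lemma perm_diagram_inj : injective (@perm_diagram n).
Proof.
move=> s t /(congr1 val)/ffunP h; apply/permP => i.
by have := h (false, i); rewrite !ffunE => -[].
Qed.

(** The regular representation of the symmetric group, read off the coefficients at permutation
    diagrams; it is linear on all of [A] and is shown multiplicative on [perm_span]. *)
Definition regular_mx (a : A) : 'M[F]_#|'S_n| :=
  \matrix_(i, j) a (perm_diagram ((enum_val i)^-1 * enum_val j)%g).

Lemma regular_mx_linear : linear regular_mx.
Proof. by move=> c a b; apply/matrixP => i j; rewrite !mxE !ffunE. Qed.

HB.instance Definition _ := GRing.isLinear.Build F A 'M[F]_#|'S_n| *:%R regular_mx regular_mx_linear.

Lemma regular_mx_rho s :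
  regular_mx (rho s) = \matrix_(i, j) ((enum_val j == enum_val i * s)%g)%:R.
Proof.
apply/matrixP => i j; rewrite !mxE ffunE (inj_eq perm_diagram_inj).
by rewrite -(inj_eq (mulgI (enum_val i))) mulKVg.
Qed.

Lemma regular_mx_rhoM s t :
  regular_mx (rho s * rho t) = regular_mx (rho s) *m regular_mx (rho t).
Proof.
rewrite rhoM !regular_mx_rho; apply/matrixP => i j; rewrite !mxE.
rewrite (bigD1 (enum_rank (enum_val i * s)%g)) //= big1 ?addr0 => [|k hk].
  by rewrite !mxE !enum_rankK eqxx mul1r mulgA.
rewrite !mxE; case: eqP => [e|_]; last exact: mul0r.
by case/eqP: hk; rewrite -e enum_valK.
Qed.

Lemma regular_mxM k a b : perm_span rho k a -> perm_span rho k b ->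
  regular_mx (a * b) = regular_mx a *m regular_mx b.
Proof.
move=> ha hb; elim: ha => [|c _ a' [s hs ->] _ IH]; first by rewrite mul0r linear0 mul0mx.
rewrite mulrDl [LHS]linearD [regular_mx (_ + a')]linearD mulmxDl -IH; congr (_ + _).
rewrite -scalerAl !linearZ /= -scalemxAl; congr (_ *: _).
elim: hb => [|d _ b' [t ht ->] _ IH']; first by rewrite mulr0 linear0 mulmx0.
rewrite mulrDr [LHS]linearD [regular_mx (_ + b')]linearD mulmxDr -IH'; congr (_ + _).
by rewrite -scalerAr !linearZ /= regular_mx_rhoM.
Qed.

Lemma rb_coefP c (u v : A) d : (c *: u + v) d = c * u d + v d.
Proof. by rewrite !ffunE. Qed.

Lemma perm_span_support k a d : perm_span rho k a -> a d != 0 ->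
  exists2 s, perm_on (low n k) s & d = perm_diagram s.
Proof.
elim=> [|c _ b [s hs ->] _ IH]; first by rewrite ffunE eqxx.
rewrite !ffunE; have [-> _|ds] := eqVneq d (perm_diagram s); first by exists s.
by rewrite scaler0 add0r.
Qed.

Lemma rho_coef (a : A) k s : perm_span rho k a ->
  (a * rho s) (perm_diagram 1) = a (perm_diagram s^-1).
Proof.
elim=> [|c _ b [t ht ->] _ IH]; first by rewrite mul0r !ffunE.
rewrite mulrDl -scalerAl rhoM !rb_coefP IH !ffunE !(inj_eq perm_diagram_inj).
by rewrite -(inj_eq (mulIg s^-1%g)) mulgK mul1g.
Qed.

(** If [a] has a nonzero coefficient at [s], then [b = a s^-1] squares to zero, so its regular
    matrix has trace zero. But this trace is that coefficient times the order of the group, nonzero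
    in characteristic zero. *)
Lemma perm_span_semiprime k a : perm_span rho k a ->
  (forall s, perm_on (low n k) s -> a * rho s * a = 0) -> a = 0.
Proof.
move=> ha h; apply/ffunP => d; rewrite ffunE; apply/eqP; apply: contraT => ad.
have [s hs dE] := perm_span_support ha ad; rewrite {}dE in ad.
pose b := a * rho s^-1%g.
have hs' : perm_on (low n k) s^-1%g by apply: perm_onV.
have hb : perm_span rho k b.
  by apply: perm_spanM => //; [exact: rhoM|apply: perm_span_rho].
have : \tr (regular_mx b) = 0.
  apply: mxtrace_sq0; rewrite -(regular_mxM hb hb) /b mulrA h // mul0r.
  exact: linear0.
rewrite /mxtrace; under eq_bigr do rewrite mxE mulVg.
rewrite sumr_const card_ord /b (rho_coef _ ha) invgK => /eqP.
rewrite -mulr_natl mulf_eq0 (negbTE ad) orbF.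
have /pcharf0P -> := char0.
by rewrite -cardsT cards_eq0 => /eqP/setP/(_ 1%g); rewrite !inE.
Qed.

End Semiprime.

(** * Splitting off the isolated vertices *)

HB.instance Definition _ (F : fieldType) n (x : F) :=
  Algebra_isFalgebra.Build F (rook_brauer n x).

Lemma mulrACA_comm (R : pzRingType) (a b c d : R) :
  GRing.comm c b -> a * b * (c * d) = a * c * (b * d).
Proof. by move=> cb; rewrite !mulrA -(mulrA a b) -cb mulrA. Qed.

Lemma prodrM_comm (R : pzRingType) I (s : seq I) (f g : I -> R) :
    (forall i j, GRing.comm (g i) (f j)) ->
  (\prod_(i <- s) f i) * (\prod_(i <- s) g i) = \prod_(i <- s) (f i * g i).
Proof.
move=> gf; elim: s => [|i s IH]; first by rewrite !big_nil mulr1.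
rewrite !big_cons mulrACA_comm ?IH //.
by apply: commr_prod => j _.
Qed.

Section Dots.
Variables (F : fieldType) (n : nat) (x : F).
Local Notation A := (rook_brauer n x).
Hypotheses (x0 : x != 0).
Local Notation rho := (@rho F n x).
Local Notation dot := (@dot F n x).
Local Notation ecup := (@ecup F n x).
Local Notation corner := (@corner F n x).
Implicit Types (S : {set 'I_n}) (u v : A).

Definition codot S : A := \prod_(i in S) (1 - dot i).

Lemma comm_codot u S : (forall i, i \in S -> GRing.comm u (dot i)) -> GRing.comm u (codot S).
Proof. by move=> h; apply: commr_prod => i iS; apply: commrB (commr1 _) (h i iS). Qed.

Lemma dot_codot1 i : dot i * (1 - dot i) = 0.
Proof. by rewrite mulrBr mulr1 dot_sq // subrr. Qed.

Lemma codotE S : codot S = \prod_i (if i \in S then 1 - dot i else 1).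
Proof. exact: big_mkcond. Qed.

Lemma codotU S S' : codot S * codot S' = codot (S :|: S').
Proof.
have comm1 (p : bool) u i : GRing.comm u (dot i) -> GRing.comm u (if p then 1 - dot i else 1).
  by case: p => h; [apply: commrB (commr1 _) h|apply: commr1].
rewrite !codotE prodrM_comm => [|i j]; last first.
  by apply/(comm1)/commr_sym/(comm1)/dotC.
apply: eq_bigr => i _; rewrite inE.
case: (i \in S); case: (i \in S'); rewrite ?mulr1 ?mul1r //=.
by rewrite mulrBl mul1r dot_codot1 subr0.
Qed.

Lemma codot_set1 i : codot [set i] = 1 - dot i.
Proof. by rewrite /codot big_set1. Qed.

Lemma codot_sub S S' : S \subset S' -> codot S * codot S' = codot S' /\ codot S' * codot S = codot S'.
Proof. by move=> h; rewrite !codotU setUC; move/setUidPl: h => ->. Qed.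

Lemma dot_codot i S : i \in S -> dot i * codot S = 0 /\ codot S * dot i = 0.
Proof.
rewrite -sub1set => /codot_sub[h1 h2]; split.
  by rewrite -h1 mulrA codot_set1 dot_codot1 mul0r.
by rewrite -h2 -mulrA codot_set1 mulrBl mul1r dot_sq // subrr mulr0.
Qed.

Lemma codot_id u S : ((forall i, i \in S -> dot i * u = 0) -> codot S * u = u) /\
  ((forall i, i \in S -> u * dot i = 0) -> u * codot S = u).
Proof.
split=> h.
  apply: (big_ind (fun y => y * u = u)) => [|y z yu zu|i iS]; first exact: mul1r.
    by rewrite -mulrA zu yu.
  by rewrite mulrBl mul1r h // subr0.
apply: (big_ind (fun y => u * y = u)) => [|y z yu zu|i iS]; first exact: mulr1.
  by rewrite mulrA yu zu.
by rewrite mulrBr mulr1 h // subr0.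
Qed.

(** Conjugation by [s] permutes the factors of [P]; accordingly [P s P] equals both [s P] and [P s],
    each by absorption. *)
Lemma codot_rho k s : perm_on (low n k) s -> GRing.comm (codot (low n k)) (rho s).
Proof.
move=> hs; set P := codot _.
have hs' : perm_on (low n k) s^-1%g by apply: perm_onV.
have rV : rho s * rho s^-1%g = 1 by rewrite rhoM mulgV.
have Vr : rho s^-1%g * rho s = 1 by rewrite rhoM mulVg.
have rho_dot t i : rho t * dot i = dot (t^-1%g i) * rho t by rewrite dot_rho permKV.
have P1 : P * (rho s * P) = rho s * P.
  apply: (codot_id _ _).1 => i iS; rewrite mulrA dot_rho -mulrA.
  by rewrite (dot_codot _).1 ?mulr0 // low_perm.
have P2 : P * rho s * P = P * rho s.
  apply: (codot_id _ _).2 => i iS; rewrite -mulrA rho_dot mulrA.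
  by rewrite (dot_codot _).2 ?mul0r // low_perm.
by rewrite /GRing.comm -P1 mulrA P2.
Qed.

Lemma comm_corner u k : (forall i : 'I_n, (k <= i)%N -> GRing.comm u (dot i)) -> (k <= n)%N ->
  GRing.comm u (corner k).
Proof.
move=> + kn; move eqm : (n - k)%N => m; elim: m k kn eqm => [|m IH] k kn eqm h.
  have -> : k = n by lia.
  by rewrite corner_n; apply: commr1.
have kn' : (k < n)%N by lia.
rewrite -[corner k](cornerS (Ordinal kn')) //; apply: commrM; first exact: h.
by apply: IH => [||i ki]; rewrite /=; [exact: kn'|lia|apply: h; exact: ltnW].
Qed.

Lemma corner_sq k : (k <= n)%N -> corner k * corner k = corner k.
Proof.
move=> kn; move eqm : (n - k)%N => m; elim: m k kn eqm => [|m IH] k kn eqm.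
  have -> : k = n by lia.
  by rewrite corner_n mulr1.
have kn' : (k < n)%N by lia.
rewrite -[X in X * _](cornerSr (Ordinal kn')) // -mulrA dot_corner //.
rewrite -[X in _ * X](cornerSr (Ordinal kn')) // mulrA IH //; last by rewrite /=; lia.
exact: cornerSr.
Qed.

(** Multiplied after [ecup i j], [dot i] and [dot j] agree, so one of the factors [1 - dot i] and
    [1 - dot j] implies the other. *)
Lemma cup_codot i j S : i \in S -> j \in S -> i != j -> ecup i j * codot S = ecup i j * codot (S :\ j).
Proof.
move=> iS jS ij; have -> : S = [set j] :|: (S :\ j) by rewrite setD1K.
rewrite -codotU setU1K ?inE ?eqxx // codot_set1.
have -> : codot (S :\ j) = codot [set i] * codot (S :\ j).
  by rewrite (codot_sub _).1 // sub1set !inE ij.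
rewrite codot_set1 !mulrA; congr (_ * _); rewrite -!mulrA mulrBl mul1r mulrBr.
by rewrite mulrA -ecup_dotr -mulrA dot_codot1 mulr0 subr0.
Qed.

End Dots.

Lemma mulr_slide (R : pzRingType) (p u c d v q : R) : GRing.comm c u -> GRing.comm d v ->
  p * (u * (c * d)) * v * q = p * c * u * v * (d * q).
Proof.
by move=> cu dv; rewrite -(mulrA p c) cu !mulrA -(mulrA _ v d) -dv !mulrA.
Qed.

(** * The projector of one level of the filtration *)

Section Level.
Variables (F : fieldType) (n : nat) (x : F).
Local Notation A := (rook_brauer n x).
Hypotheses (x0 : x != 0) (xZ : forall z : int, x != z%:~R).
Local Notation rho := (@rho F n x).
Local Notation dot := (@dot F n x).
Local Notation ecup := (@ecup F n x).
Local Notation corner := (@corner F n x).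
Local Notation codot := (@codot F n x).
Variable K : nat.
Hypothesis Kn : (K <= n)%N.
Local Notation L := (low n K).
Local Notation P := (codot L).

Definition pcup i j : A := P * ecup i j * P.

Lemma PP : P * P = P.
Proof. by rewrite codotU // setUid. Qed.

Lemma codot_cup_comm i j (S : {set 'I_n}) : i \notin S -> j \notin S -> GRing.comm (codot S) (ecup i j).
Proof.
move=> iS jS; apply/commr_sym/comm_codot => k kS; apply/commr_sym/dot_ecup_comm.
  by apply: contraNneq iS => <-.
by apply: contraNneq jS => <-.
Qed.

Lemma codot_split (S : {set 'I_n}) : S \subset L -> P = codot S * codot (L :\: S).
Proof. by move=> h; rewrite codotU // -{1}(setIidPr h) setID. Qed.

Lemma pcup_rho s i j : perm_on L s -> pcup i j * rho s = rho s * pcup (s i) (s j).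
Proof.
move=> hs; have h := codot_rho x0 hs.
by rewrite /pcup -mulrA h mulrA -(mulrA P) ecup_rho !mulrA h.
Qed.

Lemma cup_dot_cup i j : i != j -> ecup i j * dot i * ecup i j = ecup i j.
Proof.
by move=> ij; rewrite -scalerAr -scalerAl ecup_dot_ecup // scalerA mulVf // scale1r.
Qed.

(** By [cup_codot] a single factor [1 - dot i] of [P] meets the loop, where
    [e (1 - dot i) e = x e - e]; the other factors pass through. This is the origin of [x - 1]. *)
Lemma cup_P_cup i j : i \in L -> j \in L -> i != j ->
  ecup i j * P * ecup i j = (x - 1) *: (ecup i j * codot (L :\: [set i; j])).
Proof.
move=> iL jL ij; rewrite cup_codot //.
have -> : codot (L :\ j) = codot [set i] * codot (L :\: [set i; j]).
  rewrite codotU //; congr codot; apply/setP => k; rewrite !inE.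
  by have [->|ki] := eqVneq k i; rewrite /= ?ij //; rewrite inE in iL.
set C := codot (_ :\: _).
transitivity (ecup i j * (1 - dot i) * ecup i j * C).
  by rewrite codot_set1 !mulrA -(mulrA _ C) codot_cup_comm ?inE ?eqxx ?orbT // !mulrA.
rewrite mulrBr mulr1 mulrBl ecup_sq // cup_dot_cup // mulrBl scalerBl scale1r.
by rewrite -scalerAl.
Qed.

Lemma pcup_sq (i j : 'I_n) : (i < K)%N -> (j < K)%N -> i != j ->
  pcup i j * pcup i j = (x - 1) *: pcup i j.
Proof.
move=> iK jK ij; have [iL jL] : i \in L /\ j \in L by rewrite !inE.
transitivity (P * (ecup i j * P * ecup i j) * P).
  by rewrite /pcup !mulrA -(mulrA _ P P) PP.
rewrite cup_P_cup // -scalerAr -scalerAl; congr (_ *: _).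
by rewrite !mulrA -(mulrA _ (codot _) P) (codot_sub x0 (subsetDl _ _)).1.
Qed.

(** The middle [P] dissolves: [ecup i j] absorbs its factor at [j], the factor at [k] slides left
    past [ecup i j], and the rest slides right past [ecup j k], into the outer copies of [P]. *)
Lemma cup_P_cup3 i j k : i \in L -> j \in L -> k \in L -> i != j -> j != k -> i != k ->
  P * ecup i j * P * ecup j k * P = P * (ecup i j * ecup j k) * P.
Proof.
move=> iL jL kL ij jk ik.
have kLj : [set k] \subset L :\ j by rewrite sub1set !inE eq_sym jk; rewrite inE in kL.
have -> : P * ecup i j * P * ecup j k * P = P * (ecup i j * codot (L :\ j)) * ecup j k * P.
  by rewrite -cup_codot // !mulrA.
have -> : codot (L :\ j) = codot [set k] * codot (L :\: [set j; k]).
  rewrite codotU //; congr codot; apply/setP => l; rewrite !inE.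
  by have [->|lk] := eqVneq l k; rewrite /= ?orbT ?orbF // eq_sym jk; rewrite inE in kL.
rewrite mulr_slide; last 2 first.
- by apply: codot_cup_comm; rewrite inE ?ik ?jk.
- by apply: codot_cup_comm; rewrite !inE eqxx ?orbT.
rewrite (codot_sub x0 (subsetDl _ _)).1 (codot_sub x0 _).2 ?sub1set //.
by rewrite !mulrA.
Qed.

Lemma pcup_pcup (i j k : 'I_n) : (i < K)%N -> (j < K)%N -> (k < K)%N ->
    i != j -> j != k -> i != k ->
  pcup j k * pcup i j = pcup j k * rho (tperm i k) /\
  pcup i j * pcup j k = rho (tperm i k) * pcup j k.
Proof.
move=> iK jK kK ij jk ik.
have [iL jL kL] : [/\ i \in L, j \in L & k \in L] by rewrite !inE.
have pp a b c d : pcup a b * pcup c d = P * ecup a b * P * ecup c d * P.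
  by rewrite /pcup !mulrA -(mulrA _ P P) PP.
have h := codot_rho x0 (low_tperm iK kK).
split; apply: etrans (pp _ _ _ _) _; rewrite /pcup.
  rewrite (ecupC x j k) (ecupC x i j) cup_P_cup3 //; try by rewrite eq_sym.
  rewrite -(ecupC x j k) -(ecupC x i j) ecup_ecup //.
  by rewrite -!mulrA h.
rewrite cup_P_cup3 // ecup_ecupl //.
by rewrite !mulrA h.
Qed.

Lemma pcup_comm (i j k l : 'I_n) : (i < K)%N -> (j < K)%N -> (k < K)%N -> (l < K)%N ->
  i != k -> i != l -> j != k -> j != l -> pcup i j * pcup k l = pcup k l * pcup i j.
Proof.
have half (a b c d : 'I_n) : (c < K)%N -> (d < K)%N -> a != c -> a != d -> b != c -> b != d ->
    pcup a b * pcup c d = P * (ecup a b * ecup c d) * P.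
  move=> cK dK ac ad bc bd.
  have sub : [set c; d] \subset L by apply/subsetP => m; rewrite !inE => /orP[]/eqP->.
  transitivity (P * ecup a b * (codot [set c; d] * codot (L :\: [set c; d])) * ecup c d * P).
    by rewrite -codot_split // /pcup !mulrA -(mulrA _ P P) PP.
  rewrite -(mulrA P) mulr_slide; last 2 first.
  - by apply: codot_cup_comm; rewrite !inE negb_or ?ac ?ad ?bc ?bd.
  - by apply: codot_cup_comm; rewrite !inE eqxx ?orbT.
  by rewrite (codot_sub x0 (subsetDl _ _)).1 (codot_sub x0 sub).2 !mulrA.
move=> iK jK kK lK ik il jk jl; have h1 := half i j k l kK lK ik il jk jl.
have h2 : pcup k l * pcup i j = P * (ecup k l * ecup i j) * P.
  by apply: half; rewrite // eq_sym.
exact: etrans h1 (etrans (congr1 (fun u => P * u * P) (ecup_comm x ik il jk jl)) (esym h2)).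
Qed.

(** [I] stands for the ideal generated by the lower levels. From [corner k] it receives
    [corner K * dot i] for every [i < K] by conjugation, and then [corner K * ecup i j] through
    [e = e dot e]. *)
Lemma level_projector (I : A -> Prop) :
    I 0 -> (forall a b, I a -> I b -> I (a + b)) ->
    (forall a b, I b -> I (a * b)) -> (forall a b, I a -> I (a * b)) ->
    (forall k : 'I_n, K = k.+1 -> I (corner k)) ->
  exists z, [/\ z * z = z, (forall s, perm_on L s -> GRing.comm z (rho s)),
    (forall i : 'I_n, (i < K)%N -> dot i * z = 0 /\ z * dot i = 0),
    (forall i j : 'I_n, (i < K)%N -> (j < K)%N -> i != j -> ecup i j * z = 0 /\ z * ecup i j = 0) &
    [/\ z * corner K = z, corner K * z = z & I (corner K - z)]].
Proof.
move=> I0 ID IM IMr Icorner.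
have xZ' z : x - 1 != z%:~R.
  by apply: contra (xZ (z + 1)) => /eqP e; rewrite intrD -e subrK.
set f := corner K.
have f_dot i : GRing.comm f (dot i).
  by apply/commr_sym/comm_corner => // j _; apply: dotC.
have f_rho s : perm_on L s -> GRing.comm f (rho s).
  move=> hs; apply/commr_sym/comm_corner => // j Kj.
  by rewrite /GRing.comm dot_rho (low_fix hs).
have f_cup (i j : 'I_n) : (i < K)%N -> (j < K)%N -> GRing.comm f (ecup i j).
  move=> iK jK; apply/commr_sym/comm_corner => // k Kk; apply/esym/dot_ecup_comm.
    by rewrite -val_eqE /= gtn_eqF // (leq_trans iK).
  by rewrite -val_eqE /= gtn_eqF // (leq_trans jK).
have f_P : GRing.comm f P by apply: comm_codot => i _.
have I_dot (i : 'I_n) : (i < K)%N -> I (f * dot i).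
  move=> iK; case EK : K iK => [//|k]; rewrite -EK => iK.
  have kn : (k < n)%N by rewrite -EK.
  pose k' := Ordinal kn; have kK : (k' < K)%N by rewrite EK.
  have tt : rho (tperm i k') * rho (tperm i k') = 1 by rewrite rhoM tperm2.
  have -> : dot i = rho (tperm i k') * dot k' * rho (tperm i k').
    have := dot_rho x i (tperm i k'); rewrite tpermL => /(congr1 (fun y => y * rho (tperm i k'))).
    by rewrite -mulrA tt mulr1.
  rewrite !mulrA f_rho; last exact: low_tperm.
  apply: IMr; rewrite -mulrA; apply: IM.
  have -> : f = corner k'.+1 by rewrite /f EK.
  by rewrite cornerSr //; apply: Icorner.
have I_cup (i j : 'I_n) : (i < K)%N -> (j < K)%N -> i != j -> I (f * ecup i j).
  move=> iK jK ij; rewrite -(cup_dot_cup ij) !mulrA f_cup //; apply: IMr; rewrite -mulrA; apply: IM.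
  exact: I_dot.
have [z [zl zr z_comm zI [zr_id zl_id]]] :
  exists z, [/\ left_killed pcup K z, right_killed pcup K z,
    (forall u, (forall s, perm_on L s -> GRing.comm u (rho s)) ->
       (forall i j : 'I_n, (i < K)%N -> (j < K)%N -> i != j -> GRing.comm u (pcup i j)) ->
       GRing.comm u z),
    I (f * (1 - z)) &
    (forall v, right_killed pcup K v -> v * z = v) /\
    (forall v, left_killed pcup K v -> z * v = v)].
  have H1 := @brauer_projector F _ n _ (@rho1 F n x) (@rhoM F n x) K pcup (x - 1) Kn xZ'.
  have H2 := H1 (fun s i j => @pcup_rho s i j).
  apply: (H2 _ _ pcup_sq pcup_pcup pcup_comm f I K I0 ID IM IMr f_rho _ (leqnn K)).
  - by move=> i j; rewrite /pcup ecupC.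
  - move=> i j iK jK ij; have h := codot_rho x0 (low_tperm iK jK).
    rewrite /swap /pcup; split.
      transitivity (P * ecup i j * (P * rho (tperm i j))); first by rewrite mulrA.
      by rewrite [P * rho _]h mulrA -(mulrA P) ecup_tpermr.
    transitivity (rho (tperm i j) * P * (ecup i j * P)); first by rewrite !mulrA.
    by rewrite -[rho _ * P]h -mulrA (mulrA _ (ecup i j)) ecup_tperml mulrA.
  - move=> i j iK jK ij; split.
      by do 2?[apply: commrM => //]; exact: f_cup.
    rewrite /pcup !mulrA f_P; apply: IMr; rewrite -mulrA; apply: IM.
    exact: I_cup.
(* [z] is a unit for killed elements on both sides, so [z * rho s] and [rho s * z] both equal
   [z * rho s * z]. *)
have z_rho s : perm_on L s -> GRing.comm z (rho s).
  move=> hs.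
  have h1 := zr_id _ (right_killed_rho (@rho1 F n x) (@rhoM F n x) pcup_rho (leqnn K) hs zr).
  have h2 := zl_id _ (left_killed_rho pcup_rho (leqnn K) hs zl).
  by rewrite /GRing.comm -h1 -mulrA h2.
have zP : GRing.comm P z.
  apply: z_comm => [s|i j iK jK ij]; first exact: codot_rho.
  by rewrite /GRing.comm /pcup !mulrA PP -!mulrA PP.
have fz : GRing.comm f z.
  apply: z_comm => [s|i j iK jK ij]; first exact: f_rho.
  by do 2?[apply: commrM => //]; exact: f_cup.
have zz : z * z = z by exact: zl_id.
have ff : f * f = f by exact: corner_sq.
have x1 : x - 1 != 0 by have := xZ' 0.
(* The projector [z] kills only the compressed contractions [P e P]. Multiplying by [e] once more
   gives [e P e P z = 0], and cancelling the nonzero factor [x - 1] leaves [e P z = 0]. *)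
have cupPz (i j : 'I_n) : (i < K)%N -> (j < K)%N -> i != j ->
    ecup i j * (P * z) = 0 /\ z * P * ecup i j = 0.
  move=> iK jK ij; have [iL jL] : i \in L /\ j \in L by rewrite !inE.
  set C := codot (L :\: [set i; j]); have [CP PC] := codot_sub x0 (subsetDl L [set i; j]).
  have Cc : GRing.comm C (ecup i j) by apply: codot_cup_comm; rewrite !inE eqxx ?orbT.
  have cancel u : (x - 1) *: u = 0 -> u = 0 :> A.
    by move/eqP; rewrite scaler_eq0 (negbTE x1) /= => /eqP.
  split; apply: cancel.
    rewrite -CP -!mulrA (mulrA _ C) scalerAl -cup_P_cup //.
    transitivity (ecup i j * (pcup i j * z)); first by rewrite /pcup !mulrA.
    by rewrite zl // mulr0.
  rewrite -PC -!mulrA Cc scalerAr scalerAr -cup_P_cup //.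
  transitivity (z * pcup i j * ecup i j); first by rewrite /pcup !mulrA.
  by rewrite zr // mul0r.
have I_P : I (f * (1 - P)).
  suff [] : GRing.comm f P /\ I (f * (1 - P)) by [].
  apply: (big_ind (fun y => GRing.comm f y /\ I (f * (1 - y)))).
  - by split; [apply: commr1|rewrite subrr mulr0].
  - move=> u v [fu Iu] [fv Iv]; split; first exact: commrM.
    have -> : f * (1 - u * v) = f * (1 - u) + u * (f * (1 - v)).
      by rewrite (mulrA u) -fu; Ncring_tac.non_commutative_ring.
    by apply: ID => //; apply: IM.
  - move=> i; rewrite inE => iK; split; first exact: commrB (commr1 _) (f_dot i).
    have -> : f * (1 - (1 - dot i)) = f * dot i by Ncring_tac.non_commutative_ring.
    exact: I_dot.
have PzP : P * z * (P * z) = P * z by rewrite (mulrACA_comm _ _ zP) PP zz.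
have fPz : GRing.comm f (P * z) by apply: commrM.
exists (f * (P * z)); split; [|move=> s hs|move=> i iK|move=> i j iK jK ij|split].
- by rewrite (mulrACA_comm _ _ fPz) ff PzP.
- apply/commr_sym/commrM; first exact/commr_sym/f_rho.
  by apply: commrM; apply/commr_sym; [exact: codot_rho|exact: z_rho].
- have [d1 d2] : dot i * P = 0 /\ P * dot i = 0 by apply: dot_codot => //; rewrite inE.
  split; first by rewrite mulrA -f_dot -mulrA (mulrA _ P) d1 mul0r mulr0.
  by rewrite zP -!mulrA d2 !mulr0.
- have [d1 d2] := cupPz i j iK jK ij.
  split; first by rewrite mulrA -f_cup // -mulrA d1 mulr0.
  by rewrite zP -mulrA d2 mulr0.
- by rewrite fPz -mulrA ff.
- by rewrite mulrA ff.
- have -> : f - f * (P * z) = f * (1 - P) + P * (f * (1 - z)).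
    by rewrite (mulrA P) -f_P; Ncring_tac.non_commutative_ring.
  by apply: ID => //; apply: IM.
Qed.

End Level.

(** * Assembling the levels *)

Lemma card_low n k : (k <= n)%N -> #|low n k| = k.
Proof.
move=> kn; have inj : injective (widen_ord kn).
  by move=> i j /(congr1 val) /= e; apply/val_inj.
rewrite -[RHS]card_ord -(card_imset _ inj).
apply: eq_card => i; rewrite inE; apply/idP/imsetP => [ik|[j _ ->]]; last exact: (ltn_ord j).
by exists (Ordinal ik) => //; apply/val_inj.
Qed.

(** Pigeonhole: otherwise the strands from the first [k] vertices of row [t] would inject into the
    first [l < k] vertices of the other row, the rest being isolated. *)
Lemma not_all_through n (d : diagram n) t k l : (l < k <= n)%N ->
    (forall i : 'I_n, (l <= i)%N -> val d (~~ t, i) = (~~ t, i)) ->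
  exists2 i : 'I_n, (i < k)%N & (val d (t, i)).1 = t.
Proof.
move=> /andP[lk kn] fixed; have [/existsP[i /andP[ik /eqP it]]|] :=
  boolP [exists i : 'I_n, (i < k)%N && ((val d (t, i)).1 == t)]; first by exists i.
rewrite negb_exists => /forallP no.
have through (i : 'I_n) : i \in low n k -> val d (t, i) = (~~ t, (val d (t, i)).2).
  rewrite inE => ik; have := no i; rewrite ik /=.
  by case: (val d (t, i)) => [t' j] /=; case: t t' {fixed no} => -[].
have : (#|low n k| <= #|low n l|)%N.
  rewrite -(card_in_imset (f := fun i => (val d (t, i)).2) (D := low n k)); last first.
    move=> i j /through hi /through hj e; have : val d (t, i) = val d (t, j) by rewrite hi hj e.
    by move/(inv_inj (@diagramK n d)) => -[].
  apply/subset_leq_card/subsetP => _ /imsetP[i ik ->]; rewrite inE ltnNge.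
  apply/negP => /fixed; rewrite -through // diagramK through // => /(congr1 fst) /=.
  by case: (t).
rewrite (card_low kn) (card_low (leq_trans (ltnW lk) kn)).
by rewrite leqNgt lk.
Qed.

Section Levels.
Variables (F : fieldType) (n : nat) (x : F).
Local Notation A := (rook_brauer n x).
Hypotheses (x0 : x != 0).
Local Notation rho := (@rho F n x).
Local Notation dot := (@dot F n x).
Local Notation ecup := (@ecup F n x).
Local Notation corner := (@corner F n x).

Section OneLevel.
Variables (K : nat) (z : A).
Hypotheses (Kn : (K <= n)%N) (zz : z * z = z).
Hypothesis z_rho : forall s, perm_on (low n K) s -> GRing.comm z (rho s).
Hypothesis z_dot : forall i : 'I_n, (i < K)%N -> dot i * z = 0 /\ z * dot i = 0.
Hypothesis z_cup : forall i j : 'I_n, (i < K)%N -> (j < K)%N -> i != j ->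
  ecup i j * z = 0 /\ z * ecup i j = 0.
Hypotheses (zc : z * corner K = z) (cz : corner K * z = z).

Lemma top_killed (d : diagram n) (i : 'I_n) : (i < K)%N ->
    (forall j : 'I_n, (K <= j)%N -> val d (false, j) = (false, j)) ->
    (val d (false, i)).1 = false ->
  z * basis x d = 0.
Proof.
move=> iK fixed; case E : (val d (false, i)) => [t j] /= t0; rewrite {}t0 in E.
have [ji|ij] := eqVneq j i.
  by rewrite -(@dot_basis F n x d i x0) ?E ?ji // mulrA (z_dot iK).2 mul0r.
have jK : (j < K)%N.
  rewrite ltnNge; apply: contra ij => /fixed; rewrite -E diagramK E => -[->].
  exact: eqxx.
have : x *: (z * basis x d) = 0.
  by rewrite scalerAr -(ecup_basis x E) mulrA (z_cup iK jK _).2 ?mul0r // eq_sym.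
by move/eqP; rewrite scaler_eq0 (negbTE x0) => /eqP.
Qed.

Lemma bottom_killed (d : diagram n) (i : 'I_n) : (i < K)%N ->
    (forall j : 'I_n, (K <= j)%N -> val d (true, j) = (true, j)) ->
    (val d (true, i)).1 = true ->
  basis x d * z = 0.
Proof.
move=> iK fixed; case E : (val d (true, i)) => [t j] /= t0; rewrite {}t0 in E.
have [ji|ij] := eqVneq j i.
  by rewrite -(@basis_dot F n x d i x0) ?E ?ji // -mulrA (z_dot iK).1 mulr0.
have jK : (j < K)%N.
  rewrite ltnNge; apply: contra ij => /fixed; rewrite -E diagramK E => -[->].
  exact: eqxx.
have : x *: (basis x d * z) = 0.
  by rewrite scalerAl -(basis_ecup x E) -mulrA (z_cup iK jK _).1 ?mulr0 // eq_sym.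
by move/eqP; rewrite scaler_eq0 (negbTE x0) => /eqP.
Qed.

(** Every diagram in the support of [corner K * b] has at most [l < K] through strands, hence an
    isolated vertex or a horizontal edge among its first [K] top vertices, and [z] kills it. *)
Lemma level_below l b : (l < K)%N -> (forall j : 'I_n, (l <= j)%N -> b * dot j = b) -> z * b = 0.
Proof.
move=> lK hb; rewrite -zc -mulrA; set b0 := corner K * b.
rewrite [b0]rb_sum mulr_sumr big1 // => d _; rewrite -scalerAr.
have [->|bd] := eqVneq (b0 d) 0; first by rewrite scale0r.
have top (j : 'I_n) : (K <= j)%N -> val d (false, j) = (false, j).
  by move=> Kj; apply: dot_support bd; rewrite mulrA dot_corner.
have bot (j : 'I_n) : (l <= j)%N -> val d (true, j) = (true, j).
  by move=> lj; apply: support_dot bd; rewrite -mulrA hb.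
have [|i iK it] := @not_all_through n d false K l _ bot; first by rewrite lK.
by rewrite (top_killed iK top it) scaler0.
Qed.

Lemma below_level l b : (l < K)%N -> (forall j : 'I_n, (l <= j)%N -> dot j * b = b) -> b * z = 0.
Proof.
move=> lK hb; rewrite -cz mulrA; set b0 := b * corner K.
rewrite [b0]rb_sum mulr_suml big1 // => d _; rewrite -scalerAl.
have [->|bd] := eqVneq (b0 d) 0; first by rewrite scale0r.
have bot (j : 'I_n) : (K <= j)%N -> val d (true, j) = (true, j).
  by move=> Kj; apply: support_dot bd; rewrite -mulrA corner_dot.
have top (j : 'I_n) : (l <= j)%N -> val d (false, j) = (false, j).
  by move=> lj; apply: dot_support bd; rewrite mulrA hb.
have [|i iK it] := @not_all_through n d true K l _ top; first by rewrite lK.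
by rewrite (bottom_killed iK bot it) scaler0.
Qed.

(** Between two copies of [z] only diagrams with [K] through strands survive from
    [corner K * u * corner K]; these are multiples of [rho s * corner K], with [s] a permutation of
    the first [K] indices. *)
Lemma level_corner u : exists2 a, perm_span rho K a & z * u * z = a * z.
Proof.
have -> : z * u * z = z * (corner K * u * corner K) * z.
  by rewrite !mulrA zc -(mulrA _ (corner K)) cz.
set b0 := corner K * u * corner K.
rewrite [b0]rb_sum mulr_sumr mulr_suml.
apply: (big_ind (fun y => exists2 a, perm_span rho K a & y = a * z)).
- by exists 0; [constructor|rewrite mul0r].
- by move=> _ _ [a ha ->] [b hb ->]; exists (a + b); [apply: lin_spanD|rewrite mulrDl].
move=> d _; rewrite -scalerAr -scalerAl.
have [->|bd] := eqVneq (b0 d) 0; first by exists 0; [constructor|rewrite mul0r scale0r].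
suff [a ha ->] : exists2 a, perm_span rho K a & z * basis x d * z = a * z.
  by exists (b0 d *: a); [apply: lin_spanZ|rewrite -scalerAl].
have top (j : 'I_n) : (K <= j)%N -> val d (false, j) = (false, j).
  by move=> Kj; apply: dot_support bd; rewrite /b0 !mulrA dot_corner.
have bot (j : 'I_n) : (K <= j)%N -> val d (true, j) = (true, j).
  by move=> Kj; apply: support_dot bd; rewrite /b0 -[LHS]mulrA corner_dot.
have [/existsP[i /andP[iK /eqP it]]|] :=
  boolP [exists i : 'I_n, (i < K)%N && ((val d (false, i)).1 == false)].
  by exists 0; [constructor|rewrite (top_killed iK top it) !mul0r].
rewrite negb_exists => /forallP no.
have through (i : 'I_n) : (i < K)%N -> val d (false, i) = (true, (val d (false, i)).2).
  by move=> iK; have := no i; rewrite iK /=; case: (val d (false, i)) => -[].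
(* Extended by the identity from [K] on, the bijection given by the through strands is a permutation
   of all indices. *)
pose f (i : 'I_n) := if (i < K)%N then (val d (false, i)).2 else i.
have fK (i : 'I_n) : (f i < K)%N = (i < K)%N.
  rewrite /f; case: ifP => // iK; apply: contraTT isT; rewrite -leqNgt => /bot.
  by rewrite -through // diagramK through.
have f_inj : injective f.
  move=> i j e; have := fK i; rewrite e fK => ij.
  move: e; rewrite /f -ij; case: ifP => // jK e.
  have : val d (false, i) = val d (false, j).
    by rewrite (through i) -?ij // e -(through j jK).
  by move/(inv_inj (@diagramK n d)) => -[].
have hs : perm_on (low n K) (perm f_inj).
  apply/subsetP => i; rewrite !inE permE; apply: contraR => iK.
  by rewrite /f (negbTE iK).
exists (x ^+ (n - K) *: rho (perm f_inj)); first by apply/lin_spanZ/perm_span_rho.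
have <- : rho (perm f_inj) * basis x (corner_diagram n K) = basis x d.
  apply: rho_corner hs _ _ => [i iK|i t iK]; last by case: t; [apply: bot|apply: top].
  by rewrite through // permE /f iK.
have -> : rho (perm f_inj) * basis x (corner_diagram n K) =
    x ^+ (n - K) *: (rho (perm f_inj) * corner K).
  by rewrite [in RHS]scalerAr scalerA mulfV ?scale1r // expf_neq0.
rewrite -scalerAr -[LHS]scalerAl -[RHS]scalerAl; congr (_ *: _).
by rewrite mulrA z_rho // -!mulrA cz zz.
Qed.

End OneLevel.

Definition generated (T : Type) (eps : T -> A) := lin_span (fun a => exists i u v, a = u * eps i * v).

Lemma generatedM (T : Type) (eps : T -> A) a b :
  (generated eps b -> generated eps (a * b)) /\ (generated eps a -> generated eps (a * b)).
Proof.
split; elim=> [|c _ w [i [u [v ->]]] _ IH].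
- by rewrite mulr0; constructor.
- rewrite mulrDr -scalerAr; constructor => //.
  by exists i, (a * u), v; rewrite !mulrA.
- by rewrite mul0r; constructor.
- rewrite mulrDl -scalerAl; constructor => //.
  by exists i, u, (v * b); rewrite !mulrA.
Qed.

Hypotheses (char0 : [pchar F] =i pred0) (xZ : forall z : int, x != z%:~R).

(** The third clause records a level bounding each idempotent, which makes it orthogonal to the
    later projectors. The range reaches [n.+1] so that the last clause covers [corner n = 1]. *)
Lemma primitive_family k : (k <= n.+1)%N -> exists (T : finType) (eps : T -> A),
  [/\ forall i a, exists c, eps i * a * eps i = c *: eps i,
      forall i j a, i != j -> eps i * a * eps j = 0,
      forall i, exists2 l, (l < k)%N &
        forall j : 'I_n, (l <= j)%N -> dot j * eps i = eps i /\ eps i * dot j = eps i &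
      forall l, (l < k)%N -> generated eps (corner l)].
Proof.
elim: k => [|K IHK] Kn; first by exists void, (fun=> 0); split; try by case.
have [T [eps [eps_corner eps_orth eps_below eps_gen]]] := IHK (ltnW Kn).
have [z [zz z_rho z_dot z_cup [zc cz Iz]]] := level_projector x0 xZ (Kn : K <= n)%N
  (LinSpan0 _) (@lin_spanD _ _ _) (fun a b => (generatedM eps a b).1)
  (fun a b => (generatedM eps a b).2) (fun k e => eps_gen k (eq_leq (esym e))).
have two : 2 != 0 :> F by have /pcharf0P -> := char0.
have [S [Y [E [E_span E_corner E_orth E_full]]]] :=
  perm_primitives (@rho1 F n x) (@rhoM F n x) two (perm_span_semiprime char0) (Kn : K <= n)%N.
have zE u : perm_span rho K u -> GRing.comm z u by apply: perm_span_comm.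
have zEz i j u : z * E i * u * (z * E j) = E i * (z * u * z) * E j.
  by rewrite !mulrA (zE _ (E_span i)).
pose eps' (i : T + {s | Y s}) := match i with inl i => eps i | inr s => z * E (val s) end.
exists (T + {s | Y s})%type, eps'; split.
- case=> [i|s] a /=; first exact: eps_corner.
  rewrite zEz; have [b hb ->] := level_corner zz z_rho z_dot z_cup zc cz a.
  have [c hc] := E_corner (val s) b hb; exists c.
  by rewrite mulrA -mulrA (zE _ (E_span _)) mulrA hc -scalerAl.
- case=> [i|s] [j|t] a ne /=.
  + by apply: eps_orth; apply: contraNneq ne => ->.
  + have [l lK hl] := eps_below i.
    rewrite mulrA (below_level Kn z_dot z_cup cz lK) ?mul0r // => m lm.
    by rewrite mulrA (hl m lm).1.
  + have [l lK hl] := eps_below j.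
    rewrite -!mulrA (level_below Kn z_dot z_cup zc lK) // => m lm.
    by rewrite -!mulrA (hl m lm).2.
  + rewrite zEz; have [b hb ->] := level_corner zz z_rho z_dot z_cup zc cz a.
    have st : val s != val t by apply: contraNneq ne => /val_inj ->.
    by rewrite mulrA -mulrA (zE _ (E_span _)) mulrA (E_orth _ _ _ (valP s) (valP t)) ?mul0r.
- case=> [i|s].
    by have [l lK hl] := eps_below i; exists l => //; apply: ltnW.
  exists K => // j Kj /=; split; first by rewrite mulrA -cz mulrA dot_corner.
  by rewrite zE // -mulrA -{1}zc -mulrA corner_dot // zc -zE.
- have up a : generated eps a -> generated eps' a.
    elim=> [|c _ w [i [u [v ->]]] _ IH]; first by constructor.
    by constructor => //; exists (inl i), u, v.
  move=> l; rewrite ltnS leq_eqVlt => /orP[/eqP ->|/eps_gen/up //].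
  (* [corner K - z] lies in the ideal generated by the old idempotents, and [z] in that of the new
     ones, since the chosen [E i] generate [1] in the group algebra. *)
  rewrite -(subrK z (corner K)); apply: lin_spanD; first exact: up.
  rewrite -[z]mulr1; elim: E_full => [|c _ w [i [s [t [Yi hs ht ->]]]] _ IH].
    by rewrite mulr0; constructor.
  rewrite mulrDr -scalerAr; constructor => //.
  by exists (inr (Sub i Yi)), (rho s), (rho t); rewrite !mulrA z_rho.
Qed.

Lemma rook_brauer_split : rook_brauer_semisimple n x.
Proof.
have [T [eps [h1 h2 _ h3]]] := primitive_family (leqnn n.+1).
have h4 : generated eps 1 by rewrite -(corner_n n x); apply: h3.
have [k [d [phi [lin mul inj surj]]]] := split_criterion h1 h2 h4.
exists k, d, phi; split=> // i c u v.
by rewrite -lin; congr (phi i _); apply/ffunP => a; rewrite !ffunE.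
Qed.

End Levels.

Theorem theorem4p4 (F : fieldType) (hchar : [pchar F] =i pred0)
  (n : nat) (x : F) (hx0 : x != 0) (hxZ : forall z : int, x != z%:~R) :
  rook_brauer_semisimple n x.
Proof. exact: rook_brauer_split. Qed.
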